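(* Let $w$ be a pseudo-definite weight function on the disc $D_R$ of radius $R>0$, let $N\ge1$ be an integer, and let $M$ and $K$ be natural numbers satisfying $M>K$. Then the discrete polyharmonic cubature $I^{\mathrm{poly}}_{(N,M,K)}$ with parameters $(N,M,K)$ is exact with respect to $w$ on the linear subspace generated by the polynomials $$r^{2s+k}\,Y_{(k,\ell)}(\varphi),\qquad 0\le s\le 2N-1,\quad 0\le k\le M-1-K,\quad \ell=1,\dots,a_k;$$ that is, $I^{\mathrm{poly}}_{(N,M,K)}(f)=\int_{D_R}f(x)w(x)\,dx$ for every $f$ in this subspace.
   Context: Points of the plane are written $re^{i\varphi}=(r\cos\varphi,r\sin\varphi)$; $D_R$ is the disc with center $0$ and radius $R$. Put $a_0=1$, $a_k=2$ for $k\ge1$, $Y_{(0,1)}(\varphi)=1/\sqrt{2\pi}$, and for $k\ge1$: $Y_{(k,1)}(\varphi)=\frac1{\sqrt\pi}\cos k\varphi$, $Y_{(k,2)}(\varphi)=\frac1{\sqrt\pi}\sin k\varphi$. The weight $w$ is a function on $D_R$ (not necessarily non-negative), continuous except possibly at $0$. Its Fourier coefficients are $w_{(k,\ell)}(r)=\int_0^{2\pi}w(re^{i\varphi})Y_{(k,\ell)}(\varphi)\,d\varphi$ for $0<r<R$. It is called pseudo-definite if for each $(k,\ell)$ either $w_{(k,\ell)}(r)\ge0$ for all $r\in(0,R)$ or $w_{(k,\ell)}(r)\le0$ for all $r\in(0,R)$. Standing assumption: each $w_{(k,\ell)}$ is continuous on $(0,R)$ and integrable there with respect to $r\,dr$.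 For each $(k,\ell)$, the numbers $t_{1,(k,\ell)}<\dots<t_{N,(k,\ell)}$ and $\lambda_{1,(k,\ell)},\dots,\lambda_{N,(k,\ell)}$ (all positive or all negative) are the nodes and coefficients of the $N$-point Gauss (Gauss-Jacobi) quadrature for the measure $\rho^{k/2}w_{(k,\ell)}(\sqrt\rho)\,d\rho$ on $[0,R^2]$, i.e. $$\sum_{j=1}^N\lambda_{j,(k,\ell)}t_{j,(k,\ell)}^{s}=\int_0^{R^2}\rho^s\,\rho^{k/2}w_{(k,\ell)}(\sqrt\rho)\,d\rho\qquad(0\le s\le 2N-1);$$ if $w_{(k,\ell)}\equiv0$, all $\lambda_{j,(k,\ell)}$ are taken to be $0$ (with arbitrary nodes in $(0,R^2)$). The discrete polyharmonic cubature with parameters $(N,M,K)$ is $$I^{\mathrm{poly}}_{(N,M,K)}(f)=\frac{\pi}{M}\sum_{k=0}^{K}\sum_{\ell=1}^{a_k}\sum_{j=1}^{N}\sum_{s=1}^{M}\lambda_{j,(k,\ell)}\,t_{j,(k,\ell)}^{-k/2}\,Y_{(k,\ell)}\!\left(\tfrac{2\pi s}{M}\right) f\!\left(\sqrt{t_{j,(k,\ell)}}\,e^{2\pi i s/M}\right).$$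
   Formalization: A generator with k > K is admitted only if w_(k,ℓ) vanishes identically on (0,R); otherwise the claim is false (N=1, K=0, M=2, w=1+x, f=x). The disc integral is taken in polar coordinates, and equals the planar Lebesgue integral whenever fw is integrable. *)

(* Defs.v *)
(* Built on MathComp-Analysis, over an arbitrary R : realType. *)
From HB Require Import structures.
From mathcomp Require Export all_boot all_order all_algebra.
From mathcomp Require Export all_classical all_reals all_analysis.
Export Order.TTheory GRing.Theory Num.Theory.
Export numFieldNormedType.Exports.

Set Implicit Arguments.
Unset Strict Implicit.
Unset Printing Implicit Defensive.

Local Open Scope classical_set_scope.
Local Open Scope ring_scope.

Definition lin_span (F : pzRingType) (V : lmodType F) (G : set V) : set V :=
  [set f | exists (n : nat) (c : 'I_n -> F) (g : 'I_n -> V),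
      (forall i, G (g i)) /\ f = \sum_(i < n) c i *: g i].

Definition polar (R : realType) (r phi : R) : R * R := (r * cos phi, r * sin phi).

Definition open_disc (R : realType) (rad : R) : set (R * R) :=
  [set x | x.1 ^+ 2 + x.2 ^+ 2 < rad ^+ 2].

(* Angular indices are pairs (k, l) with 1 <= l <= mult k. *)
Definition mult (k : nat) : nat := if k == 0%N then 1%N else 2%N.

(* Only meaningful for 1 <= l <= mult k. *)
Definition Y (R : realType) (k l : nat) (phi : R) : R :=
  if k == 0%N then (Num.sqrt (2 * pi))^-1
  else if l == 1%N then (Num.sqrt pi)^-1 * cos (k%:R * phi)
  else (Num.sqrt pi)^-1 * sin (k%:R * phi).

Definition wcoef (R : realType) (w : R * R -> R) (k l : nat) (r : R) : R :=
  \int[lebesgue_measure]_(phi in `[0, 2 * pi]) (w (polar r phi) * Y k l phi).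

Definition vanishes_on (R : realType) (rad : R) (v : R -> R) : Prop :=
  forall r, 0 < r < rad -> v r = 0.

Definition pseudo_definite (R : realType) (rad : R) (w : R * R -> R) : Prop :=
  forall k l : nat, (1 <= l <= mult k)%N ->
    (forall r, 0 < r < rad -> 0 <= wcoef w k l r) \/
    (forall r, 0 < r < rad -> wcoef w k l r <= 0).

(* The weight is a total function on the plane, but only its values on the
   open disc minus the origin are constrained. *)
Definition weight (R : realType) (rad : R) (w : R * R -> R) : Prop :=
  {within open_disc rad `\ (0, 0), continuous w} /\
  forall k l : nat, (1 <= l <= mult k)%N ->
    {within `]0, rad[, continuous (wcoef w k l)} /\
    lebesgue_measure.-integrable `]0, rad[ (fun r => (wcoef w k l r * r)%:E).

(* N-point Gauss quadrature for rho^(k/2) v(sqrt rho) d rho on [0, rad^2]; the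
   end points, where v (sqrt rho) need not be defined, are negligible.  That
   the nodes lie in the interval is a consequence when v does not vanish. *)
Definition gauss_quadrature (R : realType) (rad : R) (N k : nat) (v : R -> R)
    (t lam : 'I_N -> R) : Prop :=
  [/\ forall i j : 'I_N, (i < j)%N -> t i < t j,
      vanishes_on rad v ->
        forall j, lam j = 0 /\ 0 < t j < rad ^+ 2 &
      ~ vanishes_on rad v ->
        ((forall j, 0 < lam j) \/ (forall j, lam j < 0)) /\
        forall s : nat, (s <= 2 * N - 1)%N ->
          ((\sum_(j < N) lam j * t j ^+ s)%:E =
           \int[lebesgue_measure]_(rho in `]0%R, (rad ^+ 2)%R[)
             (rho ^+ s * (rho `^ (k%:R / 2) * v (Num.sqrt rho)))%:E)%E].

Definition Ipoly (R : realType) (N M K : nat) (t lam : nat -> nat -> 'I_N -> R)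
    (f : R * R -> R) : R :=
  pi / M%:R *
  \sum_(0 <= k < K.+1) \sum_(1 <= l < (mult k).+1) \sum_(j < N)
    \sum_(1 <= s < M.+1)
      lam k l j * t k l j `^ (- (k%:R / 2)) * Y k l (2 * pi * s%:R / M%:R)
      * f (polar (Num.sqrt (t k l j)) (2 * pi * s%:R / M%:R)).

(* g is the function r^(2s+k) Y_(k,l)(phi) of the point r e^(i phi); the
   condition determines g on the whole plane. *)
Definition is_poly_gen (R : realType) (s k l : nat) (g : R * R -> R) : Prop :=
  forall r phi : R, 0 <= r -> g (polar r phi) = r ^+ (2 * s + k) * Y k l phi.

(* v is the integral of g over the disc.  Continuity off the origin and
   integrability of every Fourier coefficient of a weight do not make the
   weight Lebesgue integrable near the origin (nor near the boundary), so the
   integral is taken in polar coordinates, and is moreover required to be the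
   planar Lebesgue integral whenever that one exists.  Since v is finite, the
   first equation also says that the outer integral converges absolutely
   (an undefined oo - oo is infinite in the library). *)
Definition disc_integral_eq (R : realType) (rad : R) (g : R * R -> R) (v : R)
    : Prop :=
  (\int[lebesgue_measure]_(r in `]0%R, rad[)
     (r * \int[lebesgue_measure]_(phi in `[0, 2 * pi]) g (polar r phi))%R%:E
   = v%:E)%E /\
  ((lebesgue_measure \x lebesgue_measure)%E.-integrable (open_disc rad)
     (fun x => (g x)%:E) ->
   (\int[lebesgue_measure \x lebesgue_measure]_(x in open_disc rad) (g x)%:E
    = v%:E)%E).

(* Main.v *)
(* In polar coordinates [f = r^(2s+k) Y_(k,l)] integrates against [w] to the
   radial moment [int r^(2s+k) w_(k,l)(r) r dr], which the substitution
   [rho = r^2] turns into half the [s]-th moment computed by the Gauss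
   quadrature.  On the cubature side the trapezoidal sum over the [M] angles
   satisfies the orthogonality relations of the [Y_(k,l)] as long as the two
   frequencies add up to less than [M], so only the rule of index [(k,l)]
   survives.  The nodes are positive, hence [t^(-k/2)] is harmless: if
   [t_j <= 0], then [(X - t_j) prod_(i != j) (X - t_i)^2] has degree [2N-1],
   vanishes at all nodes and is nonnegative on [(0,R^2)].

   The planar integral is reduced to the polar one by Tonelli on a half disc,
   with [y = sqrt (r^2 - x^2)] at fixed [x] and then [x = r cos phi] at fixed
   [r]. *)
Require Import Defs.
From mathcomp Require Import measurable_realfun ring lra zify.

Set Implicit Arguments.
Unset Strict Implicit.
Unset Printing Implicit Defensive.

Local Open Scope classical_set_scope.
Local Open Scope ring_scope.

(** * Substitution on open intervals *)

Section substitution.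
Context {R : realType}.
Local Notation mu := (@lebesgue_measure R).
Implicit Types (G dG f g : R -> R) (a b c d : R).

(** The weight need not be integrable over the disc, so linearity cannot be borrowed from a planar
    integral. What passes to linear spans is continuity of [f] together with integrability of its
    radial integrand; for a generator the latter comes from the integrability of
    [wcoef w k l r * r]. The Jacobian r / sqrt (r^2 - x^2) of the vertical substitution blows up at
    r = |x|. Substitution is therefore done on open intervals, for nonnegative functions, by
    exhaustion with compact intervals; signs return only afterwards, through positive and negative
    parts. For k > K the cubature contains no rule of index (k, l) and gives 0, whereas the integral
    is a moment of a continuous coefficient of constant sign, which is 0 only if that coefficient
    vanishes. Hence the alternative [(k <= K)%N \/ vanishes_on rad (wcoef w k l)] imposed on
    generators. *)

Lemma itvoo_bigcup a b : a < b ->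
  `]a, b[%classic = \bigcup_n `[a + (b - a) / n.+3%:R, b - (b - a) / n.+3%:R]%classic.
Proof.
move=> ab; have ba0 : 0 < b - a by rewrite subr_gt0.
apply/seteqP; split => x /=.
- rewrite in_itv/= => /andP[ax xb].
  pose m := Num.min (x - a) (b - x).
  have m0 : 0 < m by rewrite lt_min !subr_gt0 ax.
  have [n nm] : exists n : nat, (b - a) / m < n%:R.
    by exists (Num.bound ((b - a) / m)); apply: archi_boundP; rewrite divr_ge0// ltW.
  exists n => //=; rewrite in_itv/=.
  have : (b - a) / n.+3%:R <= m.
    rewrite ler_pdivrMr// -ler_pdivrMl// mulrC (le_trans (ltW nm))//.
    by rewrite ler_nat; lia.
  rewrite le_min; move: (_ / _) => e /andP[h1 h2]; apply/andP; split; lra.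
- move=> [n _] /=; rewrite !in_itv/= => /andP[h1 h2].
  have : 0 < (b - a) / n.+3%:R by rewrite divr_gt0.
  by move: (_ / _) h1 h2 => e h1 h2 h3; apply/andP; split; lra.
Qed.

(** Monotone convergence on both sides: the segments [I n] increase to the open interval, and their
    images under [G] increase to the image of it. *)
Lemma ge0_integral_exhaustion a b G f g : a < b ->
  (forall x y, a < x -> x < y -> y < b -> measurable (G @` `[x, y]) /\
    (\int[mu]_(z in G @` `[x, y]) (f z)%:E = \int[mu]_(z in `[x, y]) (g z)%:E)%E) ->
  measurable (G @` `]a, b[) ->
  measurable_fun (G @` `]a, b[) f -> measurable_fun `]a, b[ g ->
  (forall y, (G @` `]a, b[) y -> 0 <= f y) ->
  (forall x, x \in `]a, b[ -> 0 <= g x) ->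
  (\int[mu]_(z in G @` `]a, b[) (f z)%:E = \int[mu]_(z in `]a, b[) (g z)%:E)%E.
Proof.
move=> ab H mG mf mg f0 g0.
have ba0 : 0 < b - a by rewrite subr_gt0.
pose I n : set R := `[a + (b - a) / n.+3%:R, b - (b - a) / n.+3%:R]%classic.
have IE : `]a, b[%classic = \bigcup_n I n by exact: itvoo_bigcup.
have Isub n : I n `<=` `]a, b[%classic by rewrite IE; exact: bigcup_sup.
have nd : nondecreasing_seq I.
  apply/nondecreasing_seqP => n; apply/subsetPset => x; rewrite /I/= !in_itv/=.
  have : (b - a) / n.+4%:R <= (b - a) / n.+3%:R.
    by rewrite ler_pM2l// lef_pV2 ?posrE// ler_nat.
  by move: (_ / n.+4%:R) (_ / n.+3%:R) => e e' h /andP[h1 h2]; apply/andP; split; lra.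
have GIE : G @` `]a, b[%classic = \bigcup_n (G @` I n).
  by rewrite IE image_bigcup.
have Gsub n : G @` I n `<=` G @` `]a, b[%classic by apply: image_subset.
have HI n : measurable (G @` I n) /\
    (\int[mu]_(z in G @` I n) (f z)%:E = \int[mu]_(z in I n) (g z)%:E)%E.
  have h1 : 0 < (b - a) / n.+3%:R by rewrite divr_gt0.
  (* A margin of at most a third of the length leaves the two ends of [I n] strictly ordered, as [H]
     requires; this is why the denominators start at 3. *)
  have h2 : (b - a) / n.+3%:R <= (b - a) / 3.
    by rewrite ler_pM2l// lef_pV2 ?posrE// ler_nat.
  by apply: H; move: (_ / n.+3%:R) h1 h2 => e h1 h2; lra.
have lim1 : (\int[mu]_(z in I n) (g z)%:E @[n --> \oo] -->
    \int[mu]_(z in `]a, b[) (g z)%:E)%E.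
  rewrite IE; apply: ge0_nondecreasing_set_cvg_integral => //.
  - by move=> n; exact: measurable_itv.
  - move=> n; apply/measurable_EFinP; apply: measurable_funS mg => //.
  - by move=> n x /Isub xI; rewrite lee_fin g0.
have lim2 : (\int[mu]_(z in G @` I n) (f z)%:E @[n --> \oo] -->
    \int[mu]_(z in G @` `]a, b[) (f z)%:E)%E.
  rewrite GIE; apply: ge0_nondecreasing_set_cvg_integral => //.
  - move=> m n mn; apply/subsetPset/image_subset/subsetPset; exact: nd.
  - by move=> n; exact: (HI n).1.
  - move=> n; apply/measurable_EFinP; apply: measurable_funS mf => //.
  - by move=> n x /Gsub xI; rewrite lee_fin f0.
have E : (fun n => \int[mu]_(z in G @` I n) (f z)%:E)%E =
    (fun n => \int[mu]_(z in I n) (g z)%:E)%E by apply/funext => n; exact: (HI n).2.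
rewrite E in lim2; exact: cvg_unique lim2 lim1.
Qed.

(** The derivative may be unbounded near [a] and [b]. On a segment inside []a, b[] it has one-sided
    limits at the ends, so substitution on segments applies there. The constant sign of [dG] makes
    [G] strictly monotone, hence the image of a segment is a segment, and the absolute value covers
    both orientations. *)
Lemma ge0_integration_by_substitution_oo a b c d G dG f : a < b ->
  (forall x, x \in `]a, b[ -> is_derive x 1 G (dG x)) ->
  {in `]a, b[, continuous dG} ->
  (forall x, x \in `]a, b[ -> 0 < dG x) \/ (forall x, x \in `]a, b[ -> dG x < 0) ->
  G @` `]a, b[ = `]c, d[%classic ->
  {in `]c, d[, continuous f} ->
  (forall y, y \in `]c, d[ -> 0 <= f y) ->
  (\int[mu]_(y in `]c, d[) (f y)%:E =
   \int[mu]_(x in `]a, b[) (f (G x) * `|dG x|)%:E)%E.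
Proof.
move=> ab dGP cdG sgn Gimg cf f0.
have Gcd x : x \in `]a, b[ -> G x \in `]c, d[.
  move=> xab; have : (G @` `]a, b[) (G x) by exists x.
  by rewrite Gimg.
have cG : {in `]a, b[, continuous G}.
  move=> x xab; apply: differentiable_continuous; apply/derivable1_diffP.
  by have := dGP _ xab; case.
have G'E : {in `]a, b[, (derive1 G) =1 dG}.
  by move=> x xab; rewrite derive1E; have := dGP _ xab => h; rewrite derive_val.
have cG' : {in `]a, b[, continuous (derive1 G)}.
  move=> x xab; rewrite /continuous_at G'E//.
  apply: cvg_trans (cdG _ xab); apply: near_eq_cvg.
  near=> y; rewrite G'E//; near: y; exact: near_in_itvoo.
have mGab : measurable_fun `]a, b[ G.
  by apply: open_continuous_measurable_fun; [exact: interval_open|move=> x /[!inE]; exact: cG].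
have mf : measurable_fun `]c, d[ f.
  by apply: open_continuous_measurable_fun; [exact: interval_open|move=> x /[!inE]; exact: cf].
have mdG : measurable_fun `]a, b[ dG.
  by apply: open_continuous_measurable_fun; [exact: interval_open|move=> x /[!inE]; exact: cdG].
rewrite -Gimg; apply: ge0_integral_exhaustion => //.
- move=> x y ax xy yb.
  have sub z : z \in `[x, y] -> z \in `]a, b[.
    by rewrite !in_itv/= => /andP[? ?]; apply/andP; split; lra.
  have xab : x \in `]a, b[ by apply: sub; rewrite in_itv/= lexx ltW.
  have yab : y \in `]a, b[ by apply: sub; rewrite in_itv/= lexx ltW.
  have subo z : z \in `]x, y[ -> z \in `]a, b[.
    by move=> zxy; apply: sub; exact: subset_itv_oo_cc.
  have cGxy : {within `[x, y], continuous G}.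
    by apply: continuous_in_subspaceT => z /[!inE] zxy; apply: cG; exact: sub.
  have dxy : derivable_oo_LRcontinuous G x y.
    split.
    - by move=> z zxy; have [] := dGP _ (subo _ zxy).
    - by apply: cvg_at_right_filter; exact: cG.
    - by apply: cvg_at_left_filter; exact: cG.
  have cl : cvg ((derive1 G) z @[z --> x^'+]).
    by apply/cvg_ex; exists ((derive1 G) x); apply: cvg_at_right_filter; exact: cG'.
  have cr : cvg ((derive1 G) z @[z --> y^'-]).
    by apply/cvg_ex; exists ((derive1 G) y); apply: cvg_at_left_filter; exact: cG'.
  have cG'xy : {in `]x, y[, continuous (derive1 G)} by move=> z zxy; apply: cG'; exact: subo.
  have derG z : z \in `]x, y[ -> derivable G z 1.
    by move=> zxy; have [] := dGP _ (subo _ zxy).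
  case: sgn => sgn.
  + have inc : {in `[x, y] &, {homo G : u v / u < v}}.
      by apply: gtr0_derive1_lt_cc => // z zxy; rewrite G'E ?subo//; exact/sgn/subo.
    have incle := ltW_homo_in inc.
    have GxGy : G x <= G y by apply: incle; rewrite ?bound_itvE// ltW.
    have img : G @` `[x, y] = `[G x, G y]%classic.
      apply: inc_surj_image_segment => //; first exact: ltW.
      by apply: segment_continuous_le_surjective => //; exact: ltW.
    rewrite img; split; first exact: measurable_itv.
    rewrite integration_by_substitution_increasing//; last 2 first.
    * exact: ltW.
    * apply: continuous_in_subspaceT => z /[!inE] zG; apply: cf.
      have : (G @` `[x, y]) z by rewrite img.
      by move=> [u uxy <-]; apply/Gcd/sub.
    apply: eq_integral => z /[!inE] zxy; congr EFin; rewrite !fctE.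
    by rewrite G'E ?sub// gtr0_norm// sgn ?sub.
  + have dec : {in `[x, y] &, {homo G : u v /~ u < v}}.
      by apply: ltr0_derive1_lt_cc => // z zxy; rewrite G'E ?subo//; exact/sgn/subo.
    have decle : {in `[x, y] &, {homo G : u v /~ u <= v}} := ltW_nhomo_in dec.
    have GxGy : G y <= G x by apply: decle; rewrite ?bound_itvE// ltW.
    have img : G @` `[x, y] = `[G y, G x]%classic.
      apply: dec_surj_image_segment => //; first exact: ltW.
      by apply: segment_continuous_ge_surjective => //; exact: ltW.
    rewrite img; split; first exact: measurable_itv.
    rewrite integration_by_substitution_decreasing//; last 2 first.
    * exact: ltW.
    * apply: continuous_in_subspaceT => z /[!inE] zG; apply: cf.
      have : (G @` `[x, y]) z by rewrite img.
      by move=> [u uxy <-]; apply/Gcd/sub.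
    apply: eq_integral => z /[!inE] zxy; congr EFin; rewrite !fctE.
    by rewrite G'E ?sub// ltr0_norm// sgn ?sub.
- by rewrite Gimg; exact: measurable_itv.
- by rewrite Gimg.
- apply: measurable_funM; last by apply: measurableT_comp.
  apply: (measurable_comp (measurable_itv `]c, d[)) => //.
  by move=> _ [x xab <-]; exact: Gcd.
- by move=> y [x xab <-]; apply/f0/Gcd.
- by move=> x xab; rewrite mulr_ge0// f0// Gcd.
Unshelve. all: by end_near. Qed.

End substitution.

(** * Polar coordinates *)

Section half_disc.
Context {R : realType}.
Local Notation mu := (@lebesgue_measure R).

Lemma continuous_pair (f g : R -> R) (x : R) : {for x, continuous f} ->
  {for x, continuous g} -> {for x, continuous (fun z => (f z, g z))}.
Proof.
move=> cf cg A [[U V] [/= Ux Vy] UVA].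
apply: (@filterS2 _ (nbhs x) _ _ _ _ _ (cf _ Ux) (cg _ Vy)) => z Uz Vz; exact: UVA.
Qed.

Lemma continuous_section_r (u : R * R -> R) (x y : R) :
  {for (x, y), continuous u} -> {for y, continuous (fun y => u (x, y))}.
Proof.
move=> cu; have cx : {for y, continuous (cst x : R -> R)} by exact: cvg_cst.
have ci : {for y, continuous (@id R)} by exact: cvg_id.
exact: (@continuous_comp _ _ _ _ u _ (continuous_pair cx ci) cu).
Qed.

Lemma continuous_sqrt_circle (r : R) :
  continuous (fun x : R => Num.sqrt (r ^+ 2 - x ^+ 2)).
Proof.
move=> x; apply: (@continuous_comp _ _ _ (fun x : R => r ^+ 2 - x ^+ 2) Num.sqrt).
  by apply: cvgB; [exact: cvg_cst|exact: exprn_continuous].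
exact: sqrt_continuous.
Qed.

(** Substitution y = sqrt (r^2 - x^2) at fixed x, with r running from |x| to [rad]; its derivative
    is infinite at the lower end. *)
Lemma integral_vertical_section (rad x : R) (f : R -> R) : x ^+ 2 < rad ^+ 2 ->
  0 < rad ->
  (forall y : R, 0 <= f y) ->
  {in `]0, Num.sqrt (rad ^+ 2 - x ^+ 2)[, continuous f} ->
  (\int[mu]_(y in `]0%R, Num.sqrt (rad ^+ 2 - x ^+ 2)%R[) (f y)%:E =
   \int[mu]_(r in `]`|x|%R, rad[)
     (f (Num.sqrt (r ^+ 2 - x ^+ 2)) * (r / Num.sqrt (r ^+ 2 - x ^+ 2)))%:E)%E.
Proof.
move=> xrad rad0 f0 cf.
have pos (r : R) : r \in `]`|x|, rad[ -> [/\ 0 < r, x ^+ 2 < r ^+ 2 & r ^+ 2 < rad ^+ 2].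
  rewrite in_itv/= => /andP[xr rr].
  have r0 : 0 < r by apply: le_lt_trans xr.
  by split=> //; rewrite -?[x ^+ 2]real_normK ?num_real// ltr_pXn2r// nnegrE ltW.
have der (r : R) : r \in `]`|x|, rad[ ->
    is_derive r 1 (fun r : R => Num.sqrt (r ^+ 2 - x ^+ 2)) (r / Num.sqrt (r ^+ 2 - x ^+ 2)).
  move=> /pos[r0 xr _].
  have h0 : 0 < r ^+ 2 - x ^+ 2 by rewrite subr_gt0.
  have h1 := is_derive1_sqrt h0.
  have h2 : is_derive r 1 (fun r : R => r ^+ 2 - x ^+ 2) (2 * r).
    apply: is_derive_eq; rewrite /GRing.scale/=. ring.
  have h3 := is_derive1_comp (f := Num.sqrt) (g := fun r : R => r ^+ 2 - x ^+ 2) h1 h2.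
  by apply: (is_derive_eq h3); field; rewrite gt_eqF// sqrtr_gt0.
rewrite (@ge0_integration_by_substitution_oo R `|x| rad 0 _
   (fun r : R => Num.sqrt (r ^+ 2 - x ^+ 2)) (fun r : R => r / Num.sqrt (r ^+ 2 - x ^+ 2)))//.
- apply: eq_integral => r /[!inE] /pos[r0 xr _]; congr (_ * _)%:E.
  have h0 : 0 < Num.sqrt (r ^+ 2 - x ^+ 2) by rewrite sqrtr_gt0 subr_gt0.
  by rewrite gtr0_norm// divr_gt0.
- by rewrite -(ltr_pXn2r (n := 2))// ?nnegrE// ?real_normK ?num_real// ltW.
- move=> r /pos[r0 xr _]; apply: cvgM; first exact: cvg_id.
  apply: cvgV; first by rewrite gt_eqF// sqrtr_gt0 subr_gt0.
  apply: (@continuous_comp _ _ _ (fun r : R => r ^+ 2 - x ^+ 2) Num.sqrt).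
    by apply: cvgB; [exact: exprn_continuous|exact: cvg_cst].
  exact: sqrt_continuous.
- by left=> r /pos[r0 xr _]; rewrite divr_gt0// sqrtr_gt0 subr_gt0.
- apply/seteqP; split => y /=.
  + move=> [r /pos[r0 xr rr] <-]; rewrite in_itv/= sqrtr_gt0 subr_gt0 xr/=.
    by rewrite ltr_sqrt ?subr_gt0// ltrD2r.
  + rewrite in_itv/= => /andP[y0 yr].
    have y2 : y ^+ 2 < rad ^+ 2 - x ^+ 2.
      by rewrite -[ltRHS]sqr_sqrtr ?ltr_pXn2r// ?nnegrE ?sqrtr_ge0 ?ltW// subr_gt0.
    have h : Num.sqrt (x ^+ 2 + y ^+ 2) ^+ 2 = x ^+ 2 + y ^+ 2.
      by rewrite sqr_sqrtr// addr_ge0// sqr_ge0.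
    exists (Num.sqrt (x ^+ 2 + y ^+ 2)).
      rewrite in_itv/=; apply/andP; split.
      * rewrite -sqrtr_sqr ltr_sqrt; last by rewrite ltr_wpDl ?sqr_ge0// exprn_gt0.
        by rewrite ltrDl exprn_gt0.
      * rewrite -[ltRHS]gtr0_norm// -sqrtr_sqr ltr_sqrt; last by rewrite exprn_gt0.
        by rewrite -ltrBrDl.
    by rewrite h addrAC subrr add0r sqrtr_sqr gtr0_norm.
Qed.

(** Substitution x = r cos phi, decreasing on (0, pi). There sqrt (r^2 - x^2) = r sin phi cancels
    the derivative, and only the factor [r] of polar coordinates is left over. *)
Lemma integral_circle (r : R) (u : R * R -> R) : 0 < r ->
  (forall p : R * R, 0 <= u p) ->
  (forall p : R * R, 0 < p.2 -> p.1 ^+ 2 + p.2 ^+ 2 = r ^+ 2 -> {for p, continuous u}) ->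
  (\int[mu]_(x in `](- r)%R, r[) (u (x, Num.sqrt (r ^+ 2 - x ^+ 2)) *
      (r / Num.sqrt (r ^+ 2 - x ^+ 2)))%:E =
   \int[mu]_(phi in `]0%R, pi[) (u (polar r phi) * r)%:E)%E.
Proof.
move=> r0 u0 cu.
have pos (x : R) : x \in `]- r, r[ -> 0 < r ^+ 2 - x ^+ 2.
  rewrite in_itv/= => /andP[h1 h2]; rewrite subr_sqr mulr_gt0//; lra.
have sinE (phi : R) : phi \in `]0, pi[ ->
    Num.sqrt (r ^+ 2 - (r * cos phi) ^+ 2) = r * sin phi.
  rewrite in_itv/= => phi0.
  rewrite exprMn -{1}[r ^+ 2]mulr1 -mulrBr -sin2cos2 -exprMn sqrtr_sqr.
  by rewrite gtr0_norm// mulr_gt0// sin_gt0_pi.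
have sin0 (phi : R) : phi \in `]0, pi[ -> 0 < sin phi.
  by rewrite in_itv/= => /sin_gt0_pi.
have der (phi : R) : phi \in `]0, pi[ ->
    is_derive phi 1 (fun phi : R => r * cos phi) (- (r * sin phi)).
  by move=> _; apply: is_derive_eq; rewrite /GRing.scale/=; ring.
rewrite (@ge0_integration_by_substitution_oo _ _ _ (- r) r _ _ _ (pi_gt0 R) der)//.
- apply: eq_integral => phi /[!inE] hphi; congr EFin.
  have s0 := sin0 _ hphi.
  rewrite sinE// normrN gtr0_norm ?mulr_gt0//.
  by rewrite /polar; field; rewrite !gt_eqF.
- move=> phi hphi; apply: cvgN; apply: cvgM; [exact: cvg_cst|exact: continuous_sin].
- by right=> phi /sin0 h; rewrite oppr_lt0 mulr_gt0.
- apply/seteqP; split => x /=.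
  + move=> [phi hphi <-]; have := sinE _ hphi; have s0 := sin0 _ hphi => _.
    have : (cos phi) ^+ 2 < 1 by rewrite cos2sin2 ltrBlDr ltrDl exprn_gt0.
    rewrite -[ltRHS](expr1n _ 2) -real_normK ?num_real// ltr_pXn2r ?nnegrE//.
    rewrite ltr_norml => /andP[h1 h2]; rewrite in_itv/= -[X in X < _]mulrN1.
    by rewrite -[X in _ && (_ < X)]mulr1 !ltr_pM2l// h1.
  + move=> hx; have := pos _ hx; move: hx; rewrite in_itv/= => /andP[h1 h2] h3.
    have a1 : -1 < x / r by rewrite ltr_pdivlMr// mulN1r.
    have a2 : x / r < 1 by rewrite ltr_pdivrMr// mul1r.
    exists (acos (x / r)).
      by rewrite in_itv/= acos_gt0 ?acos_ltpi// ?a1 ?a2 ?ltW.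
    by rewrite acosK ?in_itv/= ?ltW//; field; rewrite gt_eqF.
- move=> x /pos h; apply: cvgM.
    have cs := @continuous_sqrt_circle r.
    have ci : {for x, continuous (@id R)} by exact: cvg_id.
    have cp := continuous_pair ci (cs x).
    apply: (@continuous_comp _ _ _ _ u _ cp); apply: cu => /=; first by rewrite sqrtr_gt0.
    by rewrite sqr_sqrtr ?ltW// addrC subrK.
  apply: cvgM; first exact: cvg_cst.
  apply: cvgV; first by rewrite gt_eqF// sqrtr_gt0.
  exact: continuous_sqrt_circle.
- by move=> x _; rewrite !mulr_ge0 ?invr_ge0 ?sqrtr_ge0// ltW.
Qed.

Lemma measurable_polar_pair :
  measurable_fun [set: R * R] (fun p : R * R => polar p.1 p.2).
Proof.
have mfst : measurable_fun [set: R * R] (@fst R R) by exact: measurable_fst.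
have msnd : measurable_fun [set: R * R] (@snd R R) by exact: measurable_snd.
have mcos : measurable_fun [set: R] (@cos R).
  by apply: continuous_measurable_fun; exact: continuous_cos.
have msin : measurable_fun [set: R] (@sin R).
  by apply: continuous_measurable_fun; exact: continuous_sin.
apply: measurable_fun_pair; apply: measurable_funM => //.
- exact: (measurableT_comp mcos msnd).
- exact: (measurableT_comp msin msnd).
Qed.

Lemma measurable_polar (r : R) : measurable_fun [set: R] (polar r).
Proof. exact: (measurable_fun_pair2 r measurable_polar_pair). Qed.

Lemma ge0_polar_upper_half_disc (rad : R) (u : R * R -> R) : 0 < rad ->
  (forall p : R * R, 0 <= u p) ->
  measurable_fun [set: R * R] u ->
  (forall p : R * R, rad ^+ 2 <= p.1 ^+ 2 + p.2 ^+ 2 -> u p = 0) ->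
  (forall p : R * R, 0 < p.2 -> p.1 ^+ 2 + p.2 ^+ 2 < rad ^+ 2 ->
    {for p, continuous u}) ->
  (\int[mu \x mu]_p (if 0 < p.2 then u p else 0)%:E =
   \int[mu]_(r in `]0%R, rad[) (r%:E * \int[mu]_(phi in `]0%R, pi[)
     (u (polar r phi))%:E))%E.
Proof.
move=> rad0 u0 mu_ uout cu.
have mpos : measurable_fun [set: R * R] (fun p : R * R => if 0 < p.2 then u p else 0).
  apply: measurable_fun_ifT => //; apply: measurable_fun_ltr; first exact: measurable_cst.
  exact: measurable_snd.
(* The integrand in the variables (x, r) once y has been replaced, extended by 0 outside |x| < r <
   rad. The inverse of the square root is written as a power with exponent -1 so that measurability
   comes from that of the power function; both agree since the base is nonnegative. *)
pose Phi (p : R * R) := if [&& 0 < p.2, p.1 ^+ 2 < p.2 ^+ 2 & p.2 < rad] then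
  u (p.1, Num.sqrt (p.2 ^+ 2 - p.1 ^+ 2)) *
  (p.2 * Num.sqrt (p.2 ^+ 2 - p.1 ^+ 2) `^ (-1)) else 0.
have Phi0 p : 0 <= Phi p.
  rewrite /Phi; case: ifPn => // /and3P[h _ _].
  by rewrite mulr_ge0// mulr_ge0 ?powR_ge0// ltW.
have mPhi : measurable_fun [set: R * R] Phi.
  have mfst : measurable_fun [set: R * R] (@fst R R) by exact: measurable_fst.
  have msnd : measurable_fun [set: R * R] (@snd R R) by exact: measurable_snd.
  have msq : measurable_fun [set: R * R]
      (fun p : R * R => Num.sqrt (p.2 ^+ 2 - p.1 ^+ 2)).
    apply: (@measurableT_comp _ _ _ _ _ _ (@Num.sqrt R)).
      by apply: continuous_measurable_fun; exact: sqrt_continuous.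
    by apply: measurable_funB; exact: measurable_funX.
  apply: measurable_fun_ifT => //.
  - apply: measurable_and; first exact: measurable_fun_ltr.
    apply: measurable_and; last exact: measurable_fun_ltr.
    by apply: measurable_fun_ltr; exact: measurable_funX.
  - apply: measurable_funM.
      apply: (measurableT_comp mu_).
      exact: measurable_fun_pair.
    apply: measurable_funM => //.
    exact: (measurableT_comp (measurable_powR (- 1 : R)) msq).
have step1 x : (\int[mu]_y (if 0 < y then u (x, y) else 0)%:E =
    \int[mu]_r (Phi (x, r))%:E)%E.
  (* A vertical line with |x| >= rad misses the disc, and both integrals are 0. *)
  have [xr|xr] := ltP (x ^+ 2) (rad ^+ 2); last first.
    rewrite !integral0_eq// => r _.
    - rewrite /Phi/=; case: ifPn => // /and3P[r0 h1 h2].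
      have : r ^+ 2 < rad ^+ 2 by rewrite ltr_pXn2r// nnegrE ltW.
      by rewrite ltNge (le_trans xr (ltW h1)).
    - by case: ifPn => // _; rewrite uout//= (le_trans xr)// lerDl sqr_ge0.
  transitivity (\int[mu]_(y in `]0%R, Num.sqrt (rad ^+ 2 - x ^+ 2)[) (u (x, y))%:E)%E.
    rewrite [RHS]integral_mkcond; apply: eq_integral => y _.
    rewrite patchE mem_setE in_itv/=.
    have [y0|] := ltP 0 y => //=.
    have [//|h] := ltP y.
    rewrite uout//=.
    have : Num.sqrt (rad ^+ 2 - x ^+ 2) ^+ 2 <= y ^+ 2.
      by rewrite ler_pXn2r// nnegrE ?sqrtr_ge0// ltW.
    by rewrite sqr_sqrtr; [rewrite lerBlDl|rewrite subr_ge0 ltW].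
  rewrite (@integral_vertical_section _ _ (fun y => u (x, y)) xr)//; last first.
    move=> y; rewrite in_itv/= => /andP[y0 yr].
    apply: continuous_section_r; apply: cu => //=.
    rewrite -ltrBrDl -[ltRHS]sqr_sqrtr ?ltr_pXn2r// ?nnegrE ?sqrtr_ge0 ?ltW//.
    by rewrite subr_gt0.
  rewrite integral_mkcond; apply: eq_integral => r _.
  rewrite patchE mem_setE in_itv/= /Phi/=.
  have [r0|r0] := ltP 0 r; last first.
    by rewrite ltNge (le_trans r0).
  rewrite -(ltr_pXn2r (n := 2)) ?nnegrE ?(ltW r0)// real_normK ?num_real//=.
  by case: ifPn => // /andP[h1 h2]; rewrite powR_inv1 ?sqrtr_ge0.
rewrite fubini_tonelli1/=; last 2 first.
- exact/measurable_EFinP.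
- by move=> p; rewrite lee_fin; case: ifPn.
rewrite /fubini_F/=; under eq_integral do rewrite step1.
(* Exchanging the order makes [r] the outer variable; at fixed [r] what remains is the integral over
   |x| < r treated by [integral_circle]. *)
rewrite (@fubini_tonelli _ _ _ _ _ mu mu (EFin \o Phi))/=; last 2 first.
- exact/measurable_EFinP.
- by move=> p; rewrite lee_fin.
rewrite [RHS]integral_mkcond; apply: eq_integral => r _.
rewrite patchE mem_setE in_itv/=.
case: ifPn => [/andP[r0 rr]|h]; last first.
  rewrite integral0_eq// => x _; rewrite /Phi/=; case: ifPn => // /and3P[h1 _ h2].
  by rewrite h1 h2 in h.
have rr2 : r ^+ 2 < rad ^+ 2 by rewrite ltr_pXn2r// nnegrE ltW.
rewrite -ge0_integralZl//; last 3 first.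
- apply/measurable_EFinP; apply: measurable_funTS; apply: (measurableT_comp mu_).
  exact: measurable_polar.
- by move=> phi _; rewrite lee_fin.
- by rewrite lee_fin ltW.
under [RHS]eq_integral do rewrite -EFinM mulrC.
rewrite -integral_circle//; last first.
  by move=> p p2 pr; apply: cu => //; rewrite pr.
rewrite [RHS]integral_mkcond; apply: eq_integral => x _.
rewrite patchE mem_setE in_itv/= /Phi/= r0 rr/= andbT -ltr_norml.
rewrite -[`|x| < r](ltr_pXn2r (n := 2)) ?nnegrE ?(ltW r0)// real_normK ?num_real//=.
by case: ifPn => // h; rewrite powR_inv1 ?sqrtr_ge0.
Qed.

End half_disc.

(** * Nonnegative functions on the whole disc, by reflection in the horizontal axis *)

Section disc.
Context {R : realType}.
Local Notation mu := (@lebesgue_measure R).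

Lemma polar_norm (r phi : R) :
  (polar r phi).1 ^+ 2 + (polar r phi).2 ^+ 2 = r ^+ 2.
Proof. by rewrite /= !exprMn -mulrDr cos2Dsin2 mulr1. Qed.

Lemma continuous_polar (r : R) : continuous (polar r).
Proof.
move=> phi; apply: (@continuous_pair R (fun x => r * cos x) (fun x => r * sin x) phi).
  by apply: cvgM; [exact: cvg_cst|exact: continuous_cos].
by apply: cvgM; [exact: cvg_cst|exact: continuous_sin].
Qed.

Lemma polar_reflect (r phi : R) : polar r (2 * pi - phi) = ((polar r phi).1, - (polar r phi).2).
Proof.
have -> : 2 * pi = pi *+ 2 :> R by rewrite mulr_natl.
rewrite /polar cosB sinB cos2pi sin2pi /= !mul1r !mul0r addr0 sub0r mulrN.
by [].
Qed.

Lemma continuous_conj (p : R * R) : {for p, continuous (fun p : R * R => (p.1, - p.2))}.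
Proof.
move=> A [[U V] [/= Ux Vy] UVA].
have /cvgN h : snd q @[q --> p] --> p.2 by exact: cvg_snd.
have h1 : fst q @[q --> p] --> p.1 by exact: cvg_fst.
by apply: (@filterS2 _ (nbhs p) _ _ _ _ _ (h1 _ Ux) (h _ Vy)) => z Uz Vz; exact: UVA.
Qed.

(** Multiplying by the indicator of [I] turns the angular integral into a section integral of a
    nonnegative measurable function on the plane, and measurability of such integrals is part of
    Tonelli's theorem. *)
Lemma measurable_integral_polar (u : R * R -> R) (I : set R) :
  (forall p : R * R, 0 <= u p) -> measurable_fun [set: R * R] u -> measurable I ->
  measurable_fun [set: R] (fun r => \int[mu]_(phi in I) (u (polar r phi))%:E)%E.
Proof.
move=> u0 mu_ mI.
pose v (p : R * R) := \1_I p.2 * u (polar p.1 p.2).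
have mv : measurable_fun [set: R * R] (EFin \o v).
  apply/measurable_EFinP; apply: measurable_funM.
    apply: (@measurableT_comp _ _ _ _ _ _ (\1_I : R -> R) _ snd) => //.
  exact: (measurableT_comp mu_ measurable_polar_pair).
have v0 p : (0 <= (EFin \o v) p)%E by rewrite lee_fin mulr_ge0.
have := measurable_fun_fubini_tonelli_F (m2 := mu) _ mv v0.
congr (measurable_fun _ _); apply/funext => r.
rewrite /fubini_F [RHS]integral_mkcond; apply: eq_integral => phi _.
by rewrite patchE /v/= indicE; case: ifPn; rewrite ?mul1r ?mul0r.
Qed.

(** The lower half plane is carried to the upper one by (x, y) -> (x, -y), which in polar
    coordinates is phi -> 2 pi - phi. The half-disc formula is applied to [u] and to its reflection
    [v], and the two angular integrals are glued at pi. *)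
Lemma ge0_polar_disc (rad : R) (u : R * R -> R) : 0 < rad ->
  (forall p : R * R, 0 <= u p) ->
  measurable_fun [set: R * R] u ->
  (forall p : R * R, rad ^+ 2 <= p.1 ^+ 2 + p.2 ^+ 2 -> u p = 0) ->
  (forall p : R * R, 0 < p.1 ^+ 2 + p.2 ^+ 2 < rad ^+ 2 -> {for p, continuous u}) ->
  (\int[mu \x mu]_p (u p)%:E =
   \int[mu]_(r in `]0%R, rad[) (r%:E * \int[mu]_(phi in `[0%R, (2 * pi)%R])
     (u (polar r phi))%:E))%E.
Proof.
move=> rad0 u0 mu_ uout cu.
pose v (p : R * R) := u (p.1, - p.2).
have msnd : measurable_fun [set: R * R] (@snd R R) by exact: measurable_snd.
have mfst : measurable_fun [set: R * R] (@fst R R) by exact: measurable_fst.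
have v0 p : 0 <= v p by exact: u0.
have mv : measurable_fun [set: R * R] v.
  apply: (measurableT_comp mu_); apply: measurable_fun_pair => //.
  exact: measurableT_comp.
have half (w : R * R -> R) : measurable_fun [set: R * R] w ->
    measurable_fun [set: R * R] (fun p : R * R => if 0 < p.2 then w p else 0).
  by move=> mw; apply: measurable_fun_ifT => //; apply: measurable_fun_ltr.
have half' (w : R * R -> R) : measurable_fun [set: R * R] w ->
    measurable_fun [set: R * R] (fun p : R * R => if 0 < p.2 then 0 else w p).
  by move=> mw; apply: measurable_fun_ifT => //; apply: measurable_fun_ltr.
have pos (p : R * R) : 0 < p.2 -> 0 < p.1 ^+ 2 + p.2 ^+ 2.
  by move=> p0; rewrite ltr_wpDl ?sqr_ge0// exprn_gt0.
transitivity (\int[mu \x mu]_p (if 0 < p.2 then u p else 0)%:E +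
              \int[mu \x mu]_p (if 0 < p.2 then v p else 0)%:E)%E.
  transitivity (\int[mu \x mu]_p (if 0 < p.2 then u p else 0)%:E +
                \int[mu \x mu]_p (if 0 < p.2 then 0 else u p)%:E)%E.
    rewrite -ge0_integralD//=.
    - by apply: eq_integral => p _; case: ifPn; rewrite ?adde0 ?add0e.
    - by move=> p _; case: ifPn; rewrite lee_fin.
    - by apply/measurable_EFinP; exact: half.
    - by move=> p _; case: ifPn; rewrite lee_fin.
    - by apply/measurable_EFinP; exact: half'.
  congr (_ + _)%E.
  rewrite fubini_tonelli1/=; last 2 first.
  - by apply/measurable_EFinP; exact: half'.
  - by move=> p; case: ifPn; rewrite lee_fin.
  rewrite fubini_tonelli1/=; last 2 first.
  - by apply/measurable_EFinP; exact: half.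
  - by move=> p; case: ifPn; rewrite lee_fin.
  apply: eq_integral => x _; rewrite /fubini_F/=.
  have mvx : measurable_fun [set: R] (fun y => v (x, y)).
    exact: measurable_fun_pair2 mv.
  (* The lower half is the closed half-line y <= 0, while the reflected upper half is y > 0; they
     match because the point 0 has measure 0. *)
  transitivity (\int[mu]_(y in `]-oo, 0%R]) (v (x, - y))%:E)%E.
    rewrite [RHS]integral_mkcond; apply: eq_integral => y _.
    rewrite patchE mem_setE in_itv/= /v/= opprK.
    by case: ltP.
  rewrite -(@ge0_integration_by_substitution0 R (fun y => (v (x, y))%:E)); last 2 first.
  - exact/measurable_EFinP.
  - by move=> r; rewrite lee_fin.
  rewrite -integral_itv_obnd_cbnd; last first.
    by apply/measurable_EFinP; exact: measurable_funTS.
  rewrite integral_mkcond; apply: eq_integral => y _.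
  by rewrite patchE mem_setE in_itv/= andbT; case: ifPn.
rewrite (ge0_polar_upper_half_disc rad0)//; last first.
  by move=> p p2 pr; apply: cu; rewrite pos.
rewrite (ge0_polar_upper_half_disc rad0)//; last 2 first.
- by move=> p pr; rewrite /v uout//= sqrrN.
- move=> p p2 pr; apply: (continuous_comp (@continuous_conj p)).
  by apply: cu; rewrite /= sqrrN pos.
rewrite -ge0_integralD//=; last 4 first.
- move=> r; rewrite in_itv/= => /andP[r0 _]; apply: mule_ge0; first by rewrite lee_fin ltW.
  by apply: integral_ge0 => phi _; rewrite lee_fin.
- apply: emeasurable_funM; first exact/measurable_EFinP.
  by apply: measurable_funTS; exact: measurable_integral_polar.
- move=> r; rewrite in_itv/= => /andP[r0 _]; apply: mule_ge0; first by rewrite lee_fin ltW.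
  by apply: integral_ge0 => phi _; rewrite lee_fin; exact: u0.
- apply: emeasurable_funM; first exact/measurable_EFinP.
  by apply: measurable_funTS; apply: measurable_integral_polar => // p; exact: u0.
apply: eq_integral => r; rewrite inE/= in_itv/= => /andP[r0 rr].
have mup : measurable_fun [set: R] (fun phi => u (polar r phi)).
  exact: (measurableT_comp mu_ (measurable_polar r)).
rewrite -ge0_muleDr; last 2 first.
- by apply: integral_ge0 => phi _; rewrite lee_fin.
- by apply: integral_ge0 => phi _; rewrite lee_fin; exact: u0.
congr (_ * _)%E.
have p0 := pi_gt0 R.
rewrite [RHS]integral_itv_bndoo; last first.
  by apply/measurable_EFinP; exact: measurable_funTS.
(* The full circle is cut at pi: the first piece is the upper half, and the second is carried to
   []0, pi[] by x -> 2 pi - x. *)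
have -> : `]0, (2 * pi)%R[%classic = `]0, pi] `|` `]pi, (2 * pi)%R[ :> set R.
  apply/seteqP; split => x/=; rewrite !in_itv/=.
    by move=> /andP[h1 h2]; have [h|h] := leP x pi; [left|right]; rewrite ?h1 ?h2.
  by move=> [] /andP[h1 h2]; apply/andP; split; lra.
rewrite ge0_integral_setU//=; last 3 first.
- by apply/measurable_EFinP; exact: measurable_funTS.
- by move=> phi _; rewrite lee_fin.
- apply/disj_setPS => x /= []; rewrite !in_itv/= => /andP[_ h1] /andP[h2 _]; lra.
congr (_ + _)%E.
  by rewrite -integral_itv_bndo_bndc//; apply/measurable_EFinP; exact: measurable_funTS.
rewrite [RHS](@ge0_integration_by_substitution_oo R 0 pi pi (2 * pi)
  (fun x => 2 * pi - x) (fun=> - 1) (fun phi => u (polar r phi)))//.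
- apply: eq_integral => phi _; rewrite normrN1 mulr1 polar_reflect.
  by [].
- move=> x _; have h : is_derive x 1 (fun x : R => 2 * pi - x) (0 - 1) by exact: is_deriveB.
  by apply: (is_derive_eq h); rewrite sub0r.
- by move=> x _; exact: cvg_cst.
- by right=> x _; rewrite ltrN10.
- apply/seteqP; split => x /=.
    by move=> [y + <-]; rewrite !in_itv/= => /andP[h1 h2]; apply/andP; split; lra.
  rewrite in_itv/= => /andP[h1 h2]; exists (2 * pi - x); last by lra.
  by rewrite in_itv/=; apply/andP; split; lra.
- move=> x _; apply: (continuous_comp (@continuous_polar r x)).
  by apply: cu; rewrite polar_norm exprn_gt0//= ltr_pXn2r// nnegrE ltW.
Qed.

End disc.

(** * Polar coordinates for signed integrable functions *)

Section disc_signed.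
Context {R : realType}.
Local Notation mu := (@lebesgue_measure R).

Lemma continuous_sqr_norm (p : R * R) :
  {for p, continuous (fun p : R * R => p.1 ^+ 2 + p.2 ^+ 2)}.
Proof. by apply: cvgD; apply: cvgM; (exact: cvg_fst || exact: cvg_snd). Qed.

Lemma measurable_open_disc (rad : R) : measurable (open_disc rad : set (R * R)).
Proof.
have mfst : measurable_fun [set: R * R] (@fst R R) by exact: measurable_fst.
have msnd : measurable_fun [set: R * R] (@snd R R) by exact: measurable_snd.
have mlt : measurable_fun [set: R * R] (fun p : R * R => p.1 ^+ 2 + p.2 ^+ 2 < rad ^+ 2).
  apply: measurable_fun_ltr => //.
  by apply: measurable_funD; exact: measurable_funX.
have := mlt measurableT [set true] I; rewrite setTI.
by congr measurable; apply/seteqP.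
Qed.

Lemma continuous_polar_comp (h : R * R -> R) (rad r : R) :
  (forall p : R * R, 0 < p.1 ^+ 2 + p.2 ^+ 2 < rad ^+ 2 -> {for p, continuous h}) ->
  0 < r < rad -> continuous (fun phi => h (polar r phi)).
Proof.
move=> ch /andP[r0 rr] x; apply: (continuous_comp (@continuous_polar R r x)).
by apply: ch; rewrite polar_norm exprn_gt0//= ltr_pXn2r// nnegrE ltW// (lt_trans r0).
Qed.

Lemma integrable_circle (g : R -> R) : continuous g ->
  mu.-integrable `[0, 2 * pi] (EFin \o g).
Proof.
move=> cg; apply: continuous_compact_integrable; first exact: segment_compact.
by apply: continuous_subspaceT.
Qed.

(** Apply the nonnegative formula to the positive and negative parts. Planar integrability makes
    both radial integrals finite, so their difference is never oo - oo. *)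
Lemma integral_open_disc_polar (rad : R) (h : R * R -> R) : 0 < rad ->
  (forall p : R * R, 0 < p.1 ^+ 2 + p.2 ^+ 2 < rad ^+ 2 -> {for p, continuous h}) ->
  (mu \x mu)%E.-integrable (open_disc rad) (fun p => (h p)%:E) ->
  (\int[mu \x mu]_(p in open_disc rad) (h p)%:E =
   \int[mu]_(r in `]0%R, rad[)
     (r * \int[mu]_(phi in `[0, 2 * pi]) h (polar r phi))%R%:E)%E.
Proof.
move=> rad0 ch ih.
have mD := measurable_open_disc rad.
(* Cutting [h] off by 0 yields a function on the whole plane that vanishes outside the disc.
   Continuity survives inside because [g] and [h] agree near every point of the open disc. *)
pose g := h \_ (open_disc rad).
have mg : measurable_fun [set: R * R] g.
  apply/(measurable_restrictT h mD)/measurable_EFinP.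
  by have /integrableP[] := ih.
have gout (p : R * R) : rad ^+ 2 <= p.1 ^+ 2 + p.2 ^+ 2 -> g p = 0.
  by move=> pr; rewrite /g patchE memNset// /open_disc/= ltNge pr.
have gin (p : R * R) : p.1 ^+ 2 + p.2 ^+ 2 < rad ^+ 2 -> g p = h p.
  by move=> pr; rewrite /g patchE mem_set.
have cg (p : R * R) : 0 < p.1 ^+ 2 + p.2 ^+ 2 < rad ^+ 2 -> {for p, continuous g}.
  move=> /[dup] /andP[_ pr] /ch; rewrite /prop_for/continuous_at gin//.
  apply: cvg_trans; apply: near_eq_cvg; near=> q; rewrite gin//.
  by near: q; exact: (cvgr_lt _ (@continuous_sqr_norm p)).
(* [u 1] and [u (- 1)] are the positive and negative parts of [g]; the parameter lets both be
   handled by one argument. *)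
pose u (s : R) p := Num.max (s * g p) 0.
have u0 s p : 0 <= u s p by rewrite /u le_max lexx orbT.
have mu_ s : measurable_fun [set: R * R] (u s).
  by apply: measurable_maxr => //; apply: measurable_funM.
have uout s (p : R * R) : rad ^+ 2 <= p.1 ^+ 2 + p.2 ^+ 2 -> u s p = 0.
  by move=> pr; rewrite /u gout// mulr0 maxxx.
have cu s (p : R * R) : 0 < p.1 ^+ 2 + p.2 ^+ 2 < rad ^+ 2 -> {for p, continuous (u s)}.
  move=> /cg cgp; apply: continuous_max; last exact: cvg_cst.
  by apply: cvgM => //; exact: cvg_cst.
have uB p : g p = u 1 p - u (- 1) p.
  rewrite /u mul1r mulN1r; case: (leP 0 (g p)) => gp.
    by rewrite (max_idPr _) ?subr0// oppr_le0.
  by rewrite (max_idPl _) ?sub0r ?opprK// oppr_ge0 ltW.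
have ig : (mu \x mu)%E.-integrable setT (EFin \o g).
  have mD' : measurable (open_disc rad : set (measurableTypeR R * measurableTypeR R)) by exact: mD.
  have := (integrable_mkcond _ mD').1 ih.
  by rewrite restrict_EFin.
have iu s : (mu \x mu)%E.-integrable setT (EFin \o u s).
  have h1 := integrableZl measurableT s ig.
  apply: (le_integrable measurableT _ _ h1).
    by apply/measurable_EFinP; exact: mu_.
  move=> p _ /=; rewrite lee_fin ger0_norm// /u ge_max normr_ge0 andbT.
  exact: ler_norm.
have polu s := ge0_polar_disc rad0 (u0 s) (mu_ s) (uout s) (cu s).
pose A s r : \bar R := (r%:E * \int[mu]_(phi in `[0%R, (2 * pi)%R]) (u s (polar r phi))%:E)%E.
have mA s : measurable_fun `]0, rad[ (A s).
  apply: emeasurable_funM; first exact/measurable_EFinP.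
  by apply: measurable_funTS; exact: measurable_integral_polar.
have A0 s r : 0 < r < rad -> (0 <= A s r)%E.
  move=> /andP[r0 _]; apply: mule_ge0; first by rewrite lee_fin ltW.
  by apply: integral_ge0 => phi _; rewrite lee_fin.
(* By [polu] the integral of the nonnegative radial function [A s] equals the planar integral of
   [u s], which is finite. *)
have iA s : mu.-integrable `]0, rad[ (A s).
  apply/integrableP; split; first exact: mA.
  have -> : (\int[mu]_(x in `]0%R, rad[) `|A s x| = \int[mu]_(x in `]0%R, rad[) A s x)%E.
    apply: eq_integral.
    by move=> r; rewrite inE/= in_itv/= => h1; rewrite gee0_abs// A0.
  rewrite -polu; exact: integrable_lty (iu s).
transitivity (\int[mu \x mu]_p (EFin \o g) p)%E.
  by rewrite integral_mkcond restrict_EFin.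
transitivity (\int[mu \x mu]_p ((EFin \o u 1%R) \- (EFin \o u (- 1)%R)) p)%E.
  by apply: eq_integral => p _; rewrite /= uB EFinB.
have mIr : measurable (`]0%R, rad[ : set (measurableTypeR R)) by exact: measurable_itv.
rewrite (integralB measurableT (iu 1) (iu (- 1))) !polu -(integralB mIr (iA 1) (iA (- 1))).
apply: eq_integral => r; rewrite inE/= in_itv/= => hr.
(* At a fixed radius inside the disc the functions are continuous on the whole circle, so the
   angular integrals are finite and can be subtracted. *)
have ci s : continuous (fun phi => u s (polar r phi)).
  by apply: continuous_polar_comp hr; exact: cu.
have ii s := integrable_circle (ci s).
have mI : measurable (`[0%R, (2 * pi)%R] : set (measurableTypeR R)) by exact: measurable_itv.
have fi s := integrable_fin_num mI (ii s).
rewrite /A -muleBr//; last first.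
  by rewrite fin_num_adde_defl// fin_numN; exact: (fi (- 1)).
rewrite -(integralB mI (ii 1) (ii (- 1))).
rewrite EFinM; congr (_ * _)%E.
have -> : (\int[mu]_(phi in `[0%R, (2 * pi)%R])
    ((fun phi => (u 1 (polar r phi))%:E) \- (fun phi => (u (- 1) (polar r phi))%:E)) phi =
   \int[mu]_(phi in `[0%R, (2 * pi)%R]) (h (polar r phi))%:E)%E.
  apply: eq_integral => phi _; rewrite -EFinB -uB gin//.
  move: hr => /andP[r0 rr].
  by rewrite polar_norm ltr_pXn2r// nnegrE ltW.
rewrite fineK//; apply: integrable_fin_num => //.
by apply: integrable_circle; exact: continuous_polar_comp hr.
Unshelve. all: by end_near. Qed.

End disc_signed.

(** * Gauss quadrature *)

Section quadrature.
Context {R : realType}.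
Local Notation mu := (@lebesgue_measure R).

(* The domain of [lebesgue_measure] is [measurableTypeR R], whose display is
   not the default one that [measurable_itv] infers. *)
Lemma measurable_itvR (I : interval R) : measurable ([set` I] : set (measurableTypeR R)).
Proof. exact: measurable_itv. Qed.

Lemma measurable_in_oo (a b : R) (f : R -> R) :
  {in `]a, b[, continuous f} -> measurable_fun `]a, b[ f.
Proof.
move=> cf; apply: open_continuous_measurable_fun; first exact: interval_open.
by move=> x /[!inE]; exact: cf.
Qed.

Lemma integral_continuous_gt0 (a b x0 : R) (f : R -> R) :
  {in `]a, b[, continuous f} -> (forall x, x \in `]a, b[ -> 0 <= f x) ->
  x0 \in `]a, b[ -> 0 < f x0 -> (0 < \int[mu]_(x in `]a, b[) (f x)%:E)%E.
Proof.
move=> cf f0 x0ab fx0.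
have : \forall x \near x0, (x \in `]a, b[) /\ f x0 / 2 < f x.
  near=> x; split; near: x; first exact: near_in_itvoo.
  by apply: (cvgr_gt _ (cf _ x0ab)); lra.
move=> /nbhs_ballP[e /= e0 H].
have JE x : x \in `]x0 - e, x0 + e[ -> (x \in `]a, b[) /\ f x0 / 2 < f x.
  rewrite in_itv/= => /andP[h1 h2]; apply: H; rewrite /ball/= ltr_norml.
  by apply/andP; split; lra.
pose J : set (measurableTypeR R) := `]x0 - e, x0 + e[%classic.
have mJ : measurable J by exact: measurable_itvR.
have mf := measurable_in_oo cf.
have JS : J `<=` `]a, b[%classic by move=> x /JE[].
apply: (@lt_le_trans _ _ (\int[mu]_(x in J) (f x0 / 2)%:E)%E).
  rewrite integral_cst//= lebesgue_measure_itv/= lte_fin.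
  rewrite (_ : x0 - e < x0 + e); last by lra.
  rewrite -EFinB -EFinM lte_fin mulr_gt0 ?divr_gt0//; lra.
apply: (@le_trans _ _ (\int[mu]_(x in J) (f x)%:E)%E).
  apply: ge0_le_integral => //.
  - by move=> x _; rewrite lee_fin divr_ge0// ltW.
  - by apply/measurable_EFinP; exact: measurable_funS mf.
  - by move=> x /JE[_ h]; rewrite lee_fin ltW.
apply: ge0_subset_integral => //.
- exact/measurable_EFinP.
Unshelve. all: by end_near. Qed.

Lemma gauss_node_gt0 (c : R) (N : nat) (t lam : 'I_N -> R) (m : R -> R) (x0 : R) :
  injective t ->
  {in `]0, c[, continuous m} -> (forall x, x \in `]0, c[ -> 0 <= m x) ->
  x0 \in `]0, c[ -> 0 < m x0 ->
  (forall s : nat, (s <= 2 * N - 1)%N ->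
    (\sum_(j < N) lam j * t j ^+ s)%:E =
    (\int[mu]_(x in `]0%R, c[) (x ^+ s * m x)%:E)%E) ->
  forall j, 0 < t j.
Proof.
move=> injt cm m0 x0c mx0 mom j; rewrite ltNge; apply/negP => tj0.
have mI : measurable (`]0%R, c[ : set (measurableTypeR R)) by exact: measurable_itvR.
pose P := ('X - (t j)%:P) * \prod_(i < N | i != j) ('X - (t i)%:P) ^+ 2.
have sP : (size P <= 2 * N)%N.
  apply: leq_trans (size_polyMleq _ _) _.
  rewrite size_XsubC size_prod; last by move=> i _; rewrite expf_neq0 ?polyXsubC_eq0.
  under eq_bigr do rewrite size_exp_XsubC.
  rewrite sum_nat_const (_ : #|_| = N.-1); last first.
    by have := cardC1 j; rewrite card_ord => <-; apply: eq_card.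
  have := ltn_ord j; lia.
have Pt i : P.[t i] = 0.
  rewrite /P hornerM horner_prod; have [->|ij] := eqVneq i j.
    by rewrite !hornerE subrr mul0r.
  by rewrite (bigD1 i)//= horner_exp !hornerXsubC subrr expr0n/= mul0r mulr0.
have P0 x : 0 < x -> 0 <= P.[x].
  move=> x_gt0; rewrite hornerM horner_prod mulr_ge0//.
    by rewrite !hornerE; lra.
  by apply: prodr_ge0 => i _; rewrite horner_exp sqr_ge0.
have cP : continuous (fun x : R => P.[x] : R) by exact: continuous_horner.
(* The integrand is nonnegative and its integral equals a real number by [mom]. Integrability of the
   moments is what allows [P] to be integrated term by term. *)
have ims (s : nat) : (s <= 2 * N - 1)%N ->
    mu.-integrable `]0, c[ (fun x => (x ^+ s * m x)%:E).
  move=> sN; apply/integrableP; split.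
    apply/measurable_EFinP; apply: measurable_in_oo => x xc.
    by apply: cvgM; [exact: exprn_continuous|exact: cm].
  have -> : (\int[mu]_(x in `]0%R, c[) `|(x ^+ s * m x)%:E| =
      \int[mu]_(x in `]0%R, c[) (x ^+ s * m x)%:E)%E.
    apply: eq_integral => x; rewrite inE/= => xc.
    rewrite ger0_norm// mulr_ge0 ?m0// exprn_ge0//.
    by move: xc; rewrite in_itv/= => /andP[/ltW].
  by rewrite -mom// ltry.
have : (0 < \int[mu]_(x in `]0%R, c[) (P.[x] * m x)%:E)%E.
  (* [x0] may itself be a node, hence a root of [P]. Nearby points avoid the finitely many nodes
     while [m] stays positive by continuity. *)
  have [x1 [x1c mx1 Px1]] : exists x, [/\ (x \in `]0, c[), 0 < m x & 0 < P.[x]].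
    have tneq : \forall x \near x0^', forall i, x != t i.
      apply: filter_forall => i; have [->|x0t] := eqVneq x0 (t i); first exact: nbhs_dnbhs_neq.
      apply: nbhs_dnbhs; near=> x; rewrite -subr_eq0; near: x.
      apply: (cvgr_neq0 (x0 - t i)); last by rewrite subr_eq0; exact: x0t.
      by apply: cvgB; [exact: cvg_id|exact: cvg_cst].
    have mpos : \forall x \near x0^', 0 < m x.
      by apply: nbhs_dnbhs; exact: (cvgr_gt _ (cm _ x0c)).
    have xin : \forall x \near x0^', x \in `]0, c[.
      by apply: nbhs_dnbhs; exact: near_in_itvoo.
    near x0^' => x; exists x.
    have xt : forall i, x != t i by near: x.
    have xc : x \in `]0, c[ by near: x.
    split=> //; first by near: x.
    have x_gt0 : 0 < x by move: xc; rewrite in_itv/= => /andP[].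
    rewrite lt_neqAle P0// andbT eq_sym hornerM horner_prod mulf_neq0//.
      by rewrite !hornerE subr_eq0.
    by apply/prodf_neq0 => i _; rewrite horner_exp hornerXsubC expf_neq0// subr_eq0.
  apply: (@integral_continuous_gt0 _ _ x1) => //.
  - by move=> x xc; apply: cvgM; [exact: cP|exact: cm].
  - move=> x xc; rewrite mulr_ge0 ?m0// P0//.
    by move: xc; rewrite in_itv/= => /andP[].
  - by rewrite mulr_gt0.
suff -> : (\int[mu]_(x in `]0%R, c[) (P.[x] * m x)%:E = 0)%E by rewrite ltxx.
transitivity (\int[mu]_(x in `]0%R, c[)
    (\sum_(i < 2 * N) (P`_i)%:E * (x ^+ i * m x)%:E))%E.
  apply: eq_integral => x _; rewrite (horner_coef_wide _ sP) mulr_suml -sumEFin.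
  by apply: eq_bigr => i _; rewrite -EFinM mulrA.
rewrite integral_sum//; last first.
  by move=> i; apply: integrableZl => //; apply: ims; have := ltn_ord i; lia.
transitivity (\sum_(i < 2 * N) (P`_i * \sum_(j < N) lam j * t j ^+ i)%:E)%E.
  apply: eq_bigr => i _; rewrite EFinM mom; last by have := ltn_ord i; lia.
  by rewrite integralZl//; apply: ims; have := ltn_ord i; lia.
rewrite sumEFin; congr EFin.
under eq_bigr do rewrite mulr_sumr.
rewrite exchange_big/= big1// => i _.
transitivity (lam i * P.[t i]); last by rewrite Pt mulr0.
rewrite (horner_coef_wide _ sP) mulr_sumr; apply: eq_bigr => s _.
by rewrite mulrCA.
Unshelve. all: by end_near. Qed.

Lemma sqrt_in_oo (rad x : R) : 0 < rad ->
  x \in `]0, rad ^+ 2[ -> Num.sqrt x \in `]0, rad[.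
Proof.
move=> rad0; rewrite !in_itv/= => /andP[x0 xr]; rewrite sqrtr_gt0 x0/=.
by rewrite -[ltRHS]gtr0_norm// -sqrtr_sqr ltr_sqrt// exprn_gt0.
Qed.

Lemma continuous_powR_gt0 (p x : R) : 0 < x -> {for x, continuous (@powR R ^~ p)}.
Proof.
move=> x0; apply: differentiable_continuous; apply/derivable1_diffP.
by have [] := is_derive1_powR p x0.
Qed.

Lemma continuous_sqrt_density (rad p : R) (v : R -> R) : 0 < rad ->
  {in `]0, rad[, continuous v} ->
  {in `]0, rad ^+ 2[, continuous (fun x => x `^ p * v (Num.sqrt x))}.
Proof.
move=> rad0 cv x xr; apply: cvgM.
  by apply: continuous_powR_gt0; move: xr; rewrite in_itv/= => /andP[].
apply: (@continuous_comp _ _ _ Num.sqrt v); first exact: sqrt_continuous.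
exact/cv/sqrt_in_oo.
Qed.

Lemma ge0_moment_sqr (rad : R) (s k : nat) (v : R -> R) : 0 < rad ->
  {in `]0, rad[, continuous v} -> (forall r, 0 < r < rad -> 0 <= v r) ->
  (\int[mu]_(x in `]0%R, (rad ^+ 2)%R[) (x ^+ s * (x `^ (k%:R / 2) * v (Num.sqrt x)))%:E =
   2%:E * \int[mu]_(r in `]0%R, rad[) (r ^+ (2 * s + k) * (v r * r))%:E)%E.
Proof.
move=> rad0 cv v0.
have der (r : R) : r \in `]0, rad[ -> is_derive r 1 (fun r : R => r ^+ 2) (2 * r).
  by move=> _; apply: is_derive_eq; rewrite /GRing.scale/=; ring.
rewrite (@ge0_integration_by_substitution_oo _ _ _ 0 (rad ^+ 2) _ _ _ rad0 der)//.
- rewrite -ge0_integralZl//; last 2 first.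
  + apply/measurable_EFinP; apply: measurable_in_oo => r rr.
    apply: cvgM; first exact: exprn_continuous.
    by apply: cvgM; [exact: cv|exact: cvg_id].
  + move=> r; rewrite /= in_itv/= => rr; rewrite lee_fin.
    by move: (rr) => /andP[r0 _]; rewrite !mulr_ge0 ?exprn_ge0 ?v0// ltW.
  apply: eq_integral => r; rewrite inE/= in_itv/= => /andP[r0 rr].
  rewrite -EFinM; congr EFin.
  have -> : (r ^+ 2) `^ (k%:R / 2) = r ^+ k.
    rewrite -powR_mulrn ?ltW// -powRrM mulrC -mulrA mulVf// mulr1.
    by rewrite powR_mulrn// ltW.
  rewrite sqrtr_sqr gtr0_norm// gtr0_norm ?mulr_gt0// exprD exprM; ring.
- by move=> r _; apply: cvgM; [exact: cvg_cst|exact: cvg_id].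
- by left=> r; rewrite in_itv/= => /andP[r0 _]; rewrite mulr_gt0.
- apply/seteqP; split => x /=.
  + move=> [r + <-]; rewrite !in_itv/= => /andP[r0 rr].
    by rewrite exprn_gt0// ltr_pXn2r// nnegrE ltW.
  + move=> xr; exists (Num.sqrt x); first exact: sqrt_in_oo.
    by rewrite sqr_sqrtr//; move: xr; rewrite in_itv/= => /andP[/ltW].
- move=> x xr; apply: cvgM; first exact: exprn_continuous.
  exact: (@continuous_sqrt_density rad (k%:R / 2) v rad0 cv x xr).
- move=> x xr; have := sqrt_in_oo rad0 xr; rewrite in_itv/= => /v0 vx.
  rewrite !mulr_ge0 ?powR_ge0// exprn_ge0//.
  by move: xr; rewrite in_itv/= => /andP[/ltW].
Qed.

(** With a constant sign one of the positive and negative parts is 0, so the sign can be pulled out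
    even of an infinite integral. *)
Lemma le0_integralN (D : set R) (f : R -> R) : (forall x, D x -> f x <= 0) ->
  (\int[mu]_(x in D) (f x)%:E = - \int[mu]_(x in D) (- f x)%:E)%E.
Proof.
move=> f0; rewrite -integral_ge0N; last by move=> x /f0; rewrite lee_fin oppr_ge0.
by apply: eq_integral => x _; rewrite -EFinN opprK.
Qed.

Lemma moment_sqr (rad : R) (s k : nat) (v : R -> R) : 0 < rad ->
  {in `]0, rad[, continuous v} ->
  (forall r, 0 < r < rad -> 0 <= v r) \/ (forall r, 0 < r < rad -> v r <= 0) ->
  (\int[mu]_(x in `]0%R, (rad ^+ 2)%R[) (x ^+ s * (x `^ (k%:R / 2) * v (Num.sqrt x)))%:E =
   2%:E * \int[mu]_(r in `]0%R, rad[) (r ^+ (2 * s + k) * (v r * r))%:E)%E.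
Proof.
move=> rad0 cv [v0|v0]; first exact: ge0_moment_sqr.
have v0' r : 0 < r < rad -> 0 <= - v r by move=> /v0; rewrite oppr_ge0.
have cv' : {in `]0, rad[, continuous (fun r => - v r)}.
  by move=> r rr; apply: cvgN; exact: cv.
have e1 x : - (x ^+ s * (x `^ (k%:R / 2) * v (Num.sqrt x))) =
    x ^+ s * (x `^ (k%:R / 2) * - v (Num.sqrt x)) by rewrite !mulrN.
have e2 r : - (r ^+ (2 * s + k) * (v r * r)) = r ^+ (2 * s + k) * (- v r * r).
  by rewrite mulNr mulrN.
rewrite le0_integralN; last first.
  move=> x /= xr; rewrite -oppr_ge0 e1.
  have := sqrt_in_oo rad0 xr; rewrite in_itv/= => /v0' vx.
  rewrite !mulr_ge0 ?powR_ge0// exprn_ge0//.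
  by move: xr; rewrite in_itv/= => /andP[/ltW].
rewrite [in RHS]le0_integralN; last first.
  move=> r /=; rewrite in_itv/= => rr; rewrite -oppr_ge0 e2.
  by move: (rr) => /andP[r0 _]; rewrite !mulr_ge0 ?exprn_ge0 ?v0'// ltW.
rewrite muleN; congr (- _)%E.
under eq_integral do rewrite e1.
under [in RHS]eq_integral do rewrite e2.
exact: ge0_moment_sqr.
Qed.

End quadrature.

(** * Discrete orthogonality *)

Section discrete_orthogonality.
Context {R : realType}.
Implicit Types (M m k l s : nat).

Let node M s : R := 2 * pi * s%:R / M%:R.

(* Multiplying by [2 sin (pi m / M)] makes both sums telescope. *)
Lemma sum_cos_sin_node M m : (0 < m < M)%N ->
  \sum_(1 <= s < M.+1) cos (m%:R * node M s) = 0 /\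
  \sum_(1 <= s < M.+1) sin (m%:R * node M s) = 0.
Proof.
move=> /andP[m0 mM].
have M0 : M%:R != 0 :> R by rewrite pnatr_eq0; lia.
pose h : R := pi * m%:R / M%:R.
have sinh : sin h != 0.
  rewrite gt_eqF// sin_gt0_pi//; apply/andP; split.
    by rewrite divr_gt0 ?mulr_gt0 ?pi_gt0 ?ltr0n//; lia.
  rewrite /h -mulrA gtr_pMr ?pi_gt0// ltr_pdivrMr ?mul1r ?ltr_nat// ltr0n; lia.
have nodeE s : m%:R * node M s = s%:R * (2 * h) by rewrite /node /h; field.
(* The telescoped sums compare the half-step angle before the first node with the one after the
   last. They differ by [m] full turns, so sine and cosine agree there. *)
have shift : (2 * M.+1%:R - 1) * h = (2 * 1%:R - 1) * h + pi *+ 2 *+ m.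
  rewrite /h -natr1 -[_ *+ m]mulr_natr -[pi *+ 2]mulr_natl; field => //.
split; apply: (mulfI (_ : 2 * sin h != 0)); rewrite ?mulf_neq0 ?pnatr_eq0// mulr0 mulr_sumr.
- rewrite (eq_bigr (fun s => sin ((2 * s.+1%:R - 1) * h) - sin ((2 * s%:R - 1) * h))).
    rewrite (telescope_sumr (fun s => sin ((2 * s%:R - 1) * h)))//.
    by rewrite shift (periodicn (@sinD2pi R)) subrr.
  move=> s _; rewrite nodeE.
  have -> : (2 * s.+1%:R - 1) * h = s%:R * (2 * h) + h by rewrite -natr1; ring.
  have -> : (2 * s%:R - 1) * h = s%:R * (2 * h) - h by ring.
  by rewrite sinD sinB; ring.
- rewrite (eq_bigr (fun s => - cos ((2 * s.+1%:R - 1) * h) - - cos ((2 * s%:R - 1) * h))).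
    rewrite (telescope_sumr (fun s => - cos ((2 * s%:R - 1) * h)))//.
    by rewrite shift (periodicn (@cosD2pi R)) subrr.
  move=> s _; rewrite nodeE.
  have -> : (2 * s.+1%:R - 1) * h = s%:R * (2 * h) + h by rewrite -natr1; ring.
  have -> : (2 * s%:R - 1) * h = s%:R * (2 * h) - h by ring.
  by rewrite cosD cosB; ring.
Qed.

Lemma sum_cos_node M m : (m < M)%N ->
  \sum_(1 <= s < M.+1) cos (m%:R * node M s) = if m == 0%N then M%:R else 0.
Proof.
case: m => [|m] mM; last by have [] := @sum_cos_sin_node M m.+1 mM.
under eq_bigr do rewrite mul0r cos0.
by rewrite sumr_const_nat subn1.
Qed.

Lemma sum_sin_node M m : (m < M)%N ->
  \sum_(1 <= s < M.+1) sin (m%:R * node M s) = 0.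
Proof.
case: m => [|m] mM; last by have [] := @sum_cos_sin_node M m.+1 mM.
by rewrite big1// => s _; rewrite mul0r sin0.
Qed.

(** Product-to-sum formulas leave the frequencies k - k' and k + k', both below [M], so each sum
    vanishes unless its frequency is 0. The diagonal value is the same for all indices: for k >= 1
    the mean 1/2 of a squared cosine or sine meets the factor 1/pi, for k = 0 the mean 1 meets 1/(2
    pi). Taking k' <= k keeps the natural subtraction genuine. *)
Lemma Y_orthogonal M k l k' l' : (k + k' < M)%N ->
  (1 <= l <= mult k)%N -> (1 <= l' <= mult k')%N ->
  \sum_(1 <= s < M.+1) Y k l (node M s) * Y k' l' (node M s) =
  if (k == k') && (l == l') then M%:R / (2 * pi) else 0.
Proof.
wlog kk' : k l k' l' / (k' <= k)%N.
  move=> H kM hl hl'; have [h|h] := leqP k' k; first exact: H.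
  rewrite eq_sym [l == _]eq_sym -H ?(ltnW h)// 1?addnC//.
  by apply: eq_bigr => s _; rewrite mulrC.
move=> kM hl hl'.
have dM : (k - k' < M)%N by lia.
have dE s : k%:R * node M s - k'%:R * node M s = (k - k')%:R * node M s.
  by rewrite natrB// mulrBl.
have aE s : k%:R * node M s + k'%:R * node M s = (k + k')%:R * node M s.
  by rewrite natrD mulrDl.
have CC : \sum_(1 <= s < M.+1) cos (k%:R * node M s) * cos (k'%:R * node M s) =
    ((if (k - k' == 0)%N then M%:R else 0) + (if (k + k' == 0)%N then M%:R else 0)) / 2.
  rewrite -(sum_cos_node dM) -(sum_cos_node kM) -big_split/= mulr_suml.
  by apply: eq_bigr => s _; rewrite -dE -aE cosB cosD; field.
have SS : \sum_(1 <= s < M.+1) sin (k%:R * node M s) * sin (k'%:R * node M s) =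
    ((if (k - k' == 0)%N then M%:R else 0) - (if (k + k' == 0)%N then M%:R else 0)) / 2.
  rewrite -(sum_cos_node dM) -(sum_cos_node kM) -sumrB mulr_suml.
  by apply: eq_bigr => s _; rewrite -dE -aE cosB cosD; field.
have SC : \sum_(1 <= s < M.+1) sin (k%:R * node M s) * cos (k'%:R * node M s) = 0.
  transitivity ((\sum_(1 <= s < M.+1) sin ((k + k')%:R * node M s) +
     \sum_(1 <= s < M.+1) sin ((k - k')%:R * node M s)) / 2).
    rewrite -big_split/= mulr_suml.
    by apply: eq_bigr => s _; rewrite -dE -aE sinB sinD; field.
  by rewrite !sum_sin_node// addr0 mul0r.
have CS : \sum_(1 <= s < M.+1) cos (k%:R * node M s) * sin (k'%:R * node M s) = 0.
  transitivity ((\sum_(1 <= s < M.+1) sin ((k + k')%:R * node M s) -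
     \sum_(1 <= s < M.+1) sin ((k - k')%:R * node M s)) / 2).
    rewrite -sumrB mulr_suml.
    by apply: eq_bigr => s _; rewrite -dE -aE sinB sinD; field.
  by rewrite !sum_sin_node// subr0 mul0r.
pose c k : R := if k == 0%N then (Num.sqrt (2 * pi))^-1 else (Num.sqrt pi)^-1.
(* The constant [Y 0 1] is treated as a cosine of frequency 0, so that four products cover every
   pair of indices. *)
have YE j i (x : R) : (1 <= i <= mult j)%N ->
    Y j i x = c j * (if i == 1%N then cos (j%:R * x) else sin (j%:R * x)).
  rewrite /Y /mult /c; case: j => [|j] /= hi; last by case: ifP.
  by rewrite (_ : i == 1%N)//=; [rewrite mul0r cos0 mulr1 | lia].
under eq_bigr do rewrite (YE k)// (YE k')// mulrACA.
rewrite -mulr_sumr.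
have p0 := pi_gt0 R.
have c2 : c k * c k = if k == 0%N then (2 * pi)^-1 else pi^-1.
  by rewrite /c; case: ifP => _; rewrite -invfM -expr2 sqr_sqrtr// ?mulr_ge0// ltW.
have kE : (k - k' == 0)%N = (k == k') by lia.
have [l1|l1] := eqVneq l 1%N; have [l1'|l1'] := eqVneq l' 1%N.
- rewrite CC l1 l1' eqxx andbT kE; have [<-|kn] := eqVneq k k'; last first.
    by rewrite (_ : _ == _ = false) ?addr0 ?mul0r ?mulr0//; lia.
  rewrite c2 addnn double_eq0; case: ifP => _; field; lra.
- by rewrite CS mulr0 l1 [1%N == _]eq_sym (negPf l1') andbF.
- by rewrite SC mulr0 l1' (negPf l1) andbF.
- have l2 : l = 2%N by move: hl l1; rewrite /mult; case: ifP; lia.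
  have l2' : l' = 2%N by move: hl' l1'; rewrite /mult; case: ifP; lia.
  have k0 : k' != 0%N by move: hl' l1'; rewrite /mult; case: eqP => //; lia.
  rewrite SS l2 l2' eqxx andbT kE (_ : (k + k' == 0)%N = false); last by lia.
  have [kk|kn] := eqVneq k k'; last by rewrite subr0 mul0r mulr0.
  by rewrite -kk c2 kk (negPf k0); field; lra.
Qed.

End discrete_orthogonality.

(** * The cubature on generators *)

Section polynomials.
Context {R : realType}.

(** [is_poly_gen] speaks of [g] only at points in polar form; this makes it determine [g]
    everywhere. The arccosine of x / r gives an angle with nonnegative sine, and its sign is flipped
    when y < 0. *)
Lemma polar_surj (p : R * R) : exists r phi, 0 <= r /\ p = polar r phi.
Proof.
case: p => x y; pose r := Num.sqrt (x ^+ 2 + y ^+ 2).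
have r2 : r ^+ 2 = x ^+ 2 + y ^+ 2 by rewrite sqr_sqrtr// addr_ge0// sqr_ge0.
have [r0|rneq0] := eqVneq r 0.
  exists 0, 0; split=> //; rewrite /polar !mul0r.
  move: r2; rewrite r0 expr0n/= => /esym/eqP.
  by rewrite paddr_eq0 ?sqr_ge0// !sqrf_eq0 => /andP[/eqP-> /eqP->].
have r0 : 0 < r by rewrite lt_neqAle eq_sym rneq0 sqrtr_ge0.
have xr : -1 <= x / r <= 1.
  rewrite -ler_norml -(ler_pXn2r (n := 2)) ?nnegrE// expr1n real_normK ?num_real//.
  by rewrite expr_div_n ler_pdivrMr ?exprn_gt0// mul1r r2 lerDl sqr_ge0.
have sinE : r * sin (acos (x / r)) = `|y|.
  rewrite sin_acos// -{1}[r]gtr0_norm// -[`|r|]sqrtr_sqr -sqrtrM ?sqr_ge0//.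
  rewrite mulrBr mulr1 expr_div_n mulrCA divff ?mulr1; last by rewrite expf_neq0.
  by rewrite r2 addrAC subrr add0r sqrtr_sqr.
have cosE : r * cos (acos (x / r)) = x by rewrite acosK ?in_itv//=; field.
exists r; have [y0|y0] := leP 0 y.
  exists (acos (x / r)); split; first exact: ltW.
  by rewrite /polar cosE sinE ger0_norm.
exists (- acos (x / r)); split; first exact: ltW.
by rewrite /polar cosN sinN mulrN cosE sinE ltr0_norm// opprK.
Qed.

(* De Moivre: [r^k cos (k phi)] and [r^k sin (k phi)] are polynomials in the
   Cartesian coordinates. *)
Lemma solid_harmonics (k : nat) : exists c s : R * R -> R,
  [/\ continuous c, continuous s,
      forall r phi, c (polar r phi) = r ^+ k * cos (k%:R * phi) &
      forall r phi, s (polar r phi) = r ^+ k * sin (k%:R * phi)].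
Proof.
elim: k => [|k [c [s [cc cs cE sE]]]].
  exists (cst 1), (cst 0); split => //; try exact: cst_continuous.
    by move=> r phi; rewrite mul0r cos0 mulr1.
  by move=> r phi; rewrite mul0r sin0 mulr0.
exists (fun p => p.1 * c p - p.2 * s p), (fun p => p.1 * s p + p.2 * c p).
split.
- move=> p; apply: cvgB; apply: cvgM; solve [exact: cvg_fst|exact: cvg_snd|exact: cc|exact: cs].
- move=> p; apply: cvgD; apply: cvgM; solve [exact: cvg_fst|exact: cvg_snd|exact: cc|exact: cs].
- move=> r phi; rewrite cE sE /= -natr1 mulrDl mul1r cosD exprS; ring.
- move=> r phi; rewrite cE sE /= -natr1 mulrDl mul1r sinD exprS; ring.
Qed.

(** Continuity at the origin is invisible in polar form. It appears after writing [g] as a power of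
    x^2 + y^2 times a multiple of a solid harmonic. *)
Lemma continuous_poly_gen (s k l : nat) (g : R * R -> R) :
  is_poly_gen s k l g -> continuous g.
Proof.
move=> gE; have [c [c' [cc cc' cE c'E]]] := solid_harmonics k.
have cnorm : continuous (fun p : R * R => (p.1 ^+ 2 + p.2 ^+ 2) ^+ s).
  move=> p.
  apply: (@continuous_comp _ _ _ (fun p : R * R => p.1 ^+ 2 + p.2 ^+ 2) (fun x => x ^+ s)).
    exact: continuous_sqr_norm.
  exact: exprn_continuous.
suff [a [d [cd dE]]] : exists (a : R) (d : R * R -> R), continuous d /\
    forall r phi, r ^+ k * Y k l phi = a * d (polar r phi).
  have -> : g = fun p => (p.1 ^+ 2 + p.2 ^+ 2) ^+ s * (a * d p).
    apply/funext => p; have [r [phi [r0 ->]]] := polar_surj p.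
    by rewrite gE// polar_norm -dE -exprM exprD mulrA.
  by move=> p; apply: cvgM; [exact: cnorm|apply: cvgM; [exact: cvg_cst|exact: cd]].
rewrite /Y; have [k0|k0] := eqVneq k 0%N.
  exists (Num.sqrt (2 * pi))^-1, c; split=> // r phi.
  by rewrite cE k0 mul0r cos0 mulr1 mulrC.
have [_|_] := boolP (l == 1%N).
  by exists (Num.sqrt pi)^-1, c; split=> // r phi; rewrite cE mulrCA.
by exists (Num.sqrt pi)^-1, c'; split=> // r phi; rewrite c'E mulrCA.
Qed.

Lemma continuous_Y (k l : nat) : continuous (@Y R k l).
Proof.
have cmul : continuous (fun x : R => k%:R * x).
  by move=> x; apply: cvgM; [exact: cvg_cst|exact: cvg_id].
move=> x; rewrite /Y; have [_|_] := boolP (k == 0%N); first exact: cvg_cst.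
have [_|_] := boolP (l == 1%N); apply: cvgM; try exact: cvg_cst.
  exact: (continuous_comp (cmul x) (@continuous_cos R _)).
exact: (continuous_comp (cmul x) (@continuous_sin R _)).
Qed.

Lemma IpolyD (N M K : nat) (t lam : nat -> nat -> 'I_N -> R) (a : R) (g h : R * R -> R) :
  Ipoly M K t lam (a *: g + h) = a * Ipoly M K t lam g + Ipoly M K t lam h.
Proof.
rewrite /Ipoly mulrCA -mulrDr; congr (_ * _).
do 2 (rewrite mulr_sumr -big_split/=; apply: eq_bigr => ? _).
do 2 (rewrite mulr_sumr -big_split/=; apply: eq_bigr => ? _).
by rewrite !fctE /GRing.scale/=; ring.
Qed.

Lemma Ipoly0 (N M K : nat) (t lam : nat -> nat -> 'I_N -> R) :
  Ipoly M K t lam 0 = 0.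
Proof.
rewrite /Ipoly; do 4 (rewrite big1 ?mulr0// => ? _).
exact: mulr0.
Qed.

(** At radius sqrt t the factor t^(-k/2) of the cubature cancels r^k, leaving exactly the power t^s
    seen by the Gauss rule. *)
Lemma powR_sqrt_pow (x : R) (s k : nat) : 0 < x ->
  x `^ (- (k%:R / 2)) * Num.sqrt x ^+ (2 * s + k) = x ^+ s.
Proof.
move=> x0; have s0 : 0 < Num.sqrt x by rewrite sqrtr_gt0.
rewrite powRN [k%:R / 2]mulrC powRrM powR12_sqrt ?ltW// powR_mulrn ?ltW//.
rewrite exprD exprM sqr_sqrtr ?ltW//; field.
by rewrite expf_neq0// gt_eqF.
Qed.

(** Every index k' of the cubature is at most [K], so k + k' <= M - 1 and orthogonality applies on
    each circle of nodes. Only the index (k, l) contributes, provided that it is summed at all, and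
    pi / M times M / (2 pi) gives the factor 1/2. *)
Lemma Ipoly_gen (N M K s k l : nat) (t lam : nat -> nat -> 'I_N -> R) (g : R * R -> R) :
  (K < M)%N -> (k <= M - 1 - K)%N -> (1 <= l <= mult k)%N ->
  (forall j, 0 < t k l j) -> is_poly_gen s k l g ->
  Ipoly M K t lam g =
  if (k <= K)%N then (\sum_(j < N) lam k l j * t k l j ^+ s) / 2 else 0.
Proof.
move=> KM kM hl t0 gE.
have M0 : M%:R != 0 :> R by rewrite pnatr_eq0; lia.
have p0 := pi_gt0 R.
(* The contribution of the index (k', l') if its angular sum took the diagonal value M / (2 pi). *)
pose V k' l' := \sum_(j < N) lam k' l' j * t k' l' j `^ (- (k'%:R / 2)) *
  Num.sqrt (t k' l' j) ^+ (2 * s + k) * (M%:R / (2 * pi)).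
transitivity (pi / M%:R * \sum_(0 <= k' < K.+1 | k' == k)
    \sum_(1 <= l' < (mult k').+1 | l' == l) V k' l').
  rewrite /Ipoly; congr (_ * _); rewrite [RHS]big_mkcond/=.
  apply: eq_big_nat => k' k'K.
  rewrite [in RHS]big_mkcond/= -[LHS]/(\sum_(1 <= l' < (mult k').+1) _).
  transitivity (\sum_(1 <= l' < (mult k').+1)
      if (k' == k) && (l' == l) then V k' l' else 0).
    apply: eq_big_nat => l' hl'.
    transitivity (\sum_(j < N) lam k' l' j * t k' l' j `^ (- (k'%:R / 2)) *
        Num.sqrt (t k' l' j) ^+ (2 * s + k) *
        (if (k' == k) && (l' == l) then M%:R / (2 * pi) else 0)).
      apply: eq_bigr => j _; rewrite -(@Y_orthogonal R M)//; try lia.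
      rewrite mulr_sumr; apply: eq_bigr => i _.
      by rewrite gE ?sqrtr_ge0//; ring.
    case: ifP => // _; by rewrite big1// => j _; rewrite mulr0.
  by case: eqP => //= _; rewrite big1.
rewrite big_nat1_eq ltnS leq0n/=; case: ifP => // _; last by rewrite mulr0.
rewrite big_nat1_eq ltnS hl /V mulr_suml mulr_sumr; apply: eq_bigr => j _.
rewrite -(powR_sqrt_pow s k (t0 j)); move: (pi : R) p0 => q q0; field.
by rewrite M0 gt_eqF.
Qed.

End polynomials.

(** * Exactness *)

Section exactness.
Context {R : realType}.
Local Notation mu := (@lebesgue_measure R).
Variables (rad : R) (w : R * R -> R).
Hypotheses (rad0 : 0 < rad) (hw : weight rad w).

(** The punctured disc is open, being the preimage of []0, rad ^+ 2[] under x^2 + y^2, so continuity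
    within it is continuity at each of its points. *)
Lemma weight_continuous (p : R * R) :
  0 < p.1 ^+ 2 + p.2 ^+ 2 < rad ^+ 2 -> {for p, continuous w}.
Proof.
move=> pr; have [cw _] := hw; move: cw.
have -> : open_disc rad `\ (0, 0) =
    (fun p : R * R => p.1 ^+ 2 + p.2 ^+ 2) @^-1` `]0, rad ^+ 2[.
  apply/seteqP; split => -[x y]; rewrite /open_disc/= in_itv/=.
    move=> [-> /eqP]; rewrite xpair_eqE negb_and andbT => xy.
    rewrite lt_neqAle addr_ge0 ?sqr_ge0// andbT eq_sym.
    by rewrite paddr_eq0 ?sqr_ge0// !sqrf_eq0 negb_and.
  move=> /andP[h ->]; split=> // -[x0 y0].
  by move: h; rewrite x0 y0 expr0n/= addr0 ltxx.
rewrite continuous_open_subspace; last first.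
  apply: open_comp; last exact: interval_open.
  by move=> x _; exact: continuous_sqr_norm.
by apply; rewrite inE/= in_itv.
Qed.

Lemma weight_circle (r : R) : 0 < r < rad -> continuous (fun phi => w (polar r phi)).
Proof. exact: continuous_polar_comp weight_continuous. Qed.

Lemma integrable_weight_circle (f : R * R -> R) (r : R) : continuous f ->
  0 < r < rad ->
  mu.-integrable `[0, 2 * pi] (fun phi => (f (polar r phi) * w (polar r phi))%:E).
Proof.
move=> cf hr; apply: (integrable_circle (g := fun phi => f (polar r phi) * w (polar r phi))).
move=> phi; apply: cvgM; last exact: weight_circle.
exact: (continuous_comp (@continuous_polar R r phi) (cf _)).
Qed.

Definition polar_integral (f : R * R -> R) (r : R) : \bar R :=
  (r * \int[mu]_(phi in `[0, 2 * pi]) (f (polar r phi) * w (polar r phi)))%:E.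

(** Continuity of [f] makes the integrals over circles additive, and integrability of
    [polar_integral f] does the same for the integral over radii; with both included, the property
    is stable under linear combinations. *)
Definition has_polar_integral (f : R * R -> R) (v : R) : Prop :=
  [/\ continuous f, mu.-integrable `]0, rad[ (polar_integral f) &
      (\int[mu]_(r in `]0%R, rad[) polar_integral f r = v%:E)%E].

Lemma has_polar_integral0 : has_polar_integral 0 0.
Proof.
have E : polar_integral 0 = cst 0%E.
  apply/funext => r; rewrite /polar_integral/=; congr EFin.
  rewrite (_ : (fun phi => _) = cst 0); last by apply/funext => phi; rewrite mul0r.
  by rewrite Rintegral_cst// mul0r mulr0.
split; first exact: cst_continuous.
- by rewrite E; exact: integrable0.
- by rewrite E integral0.
Qed.

Lemma has_polar_integralD (a u v : R) (g h : R * R -> R) :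
  has_polar_integral g u -> has_polar_integral h v ->
  has_polar_integral (a *: g + h) (a * u + v).
Proof.
move=> [cg ig gu] [ch ih hv].
have mI := measurable_itvR `]0, rad[.
have mJ := measurable_itvR `[0, 2 * pi : R].
have E r : 0 < r < rad ->
    polar_integral (a *: g + h) r = (a%:E * polar_integral g r + polar_integral h r)%E.
  move=> hr; rewrite /polar_integral -EFinM -EFinD; congr EFin.
  have i1 := integrable_weight_circle cg hr.
  have i2 := integrable_weight_circle ch hr.
  have i3 : mu.-integrable `[0, 2 * pi]
      (EFin \o (fun phi => a * (g (polar r phi) * w (polar r phi)))).
    exact: (integrableZl mJ a i1).
  transitivity (r * \int[mu]_(phi in `[0, 2 * pi])
     (a * (g (polar r phi) * w (polar r phi)) + h (polar r phi) * w (polar r phi))).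
    by congr (_ * _); apply: eq_Rintegral => phi _; rewrite !fctE /GRing.scale/=; ring.
  rewrite (RintegralD mJ i3 i2) (RintegralZl _ mJ i1); ring.
have iag := integrableZl mI a ig.
split.
- by move=> p; apply: cvgD; [apply: cvgM; [exact: cvg_cst|exact: cg]|exact: ch].
- apply: eq_integrable (integrableD mI iag ih) => //.
  by move=> r; rewrite inE/= in_itv/= => hr; rewrite E.
- transitivity (\int[mu]_(r in `]0%R, rad[)
      (a%:E * polar_integral g r + polar_integral h r))%E.
    by apply: eq_integral => r; rewrite inE/= in_itv/= => hr; rewrite E.
  by rewrite (integralD mI iag ih) (integralZl mI ig) gu hv.
Qed.

Lemma polar_integral_gen (s k l : nat) (g : R * R -> R) (r : R) :
  is_poly_gen s k l g -> 0 < r < rad ->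
  polar_integral g r = (r ^+ (2 * s + k) * (wcoef w k l r * r))%:E.
Proof.
move=> gE hr; have mJ := measurable_itvR `[0, 2 * pi : R].
have r0 : 0 <= r by move: hr => /andP[/ltW].
have i1 : mu.-integrable `[0, 2 * pi] (EFin \o (fun phi => w (polar r phi) * Y k l phi)).
  apply: integrable_circle => phi.
  by apply: cvgM; [exact: weight_circle|exact: continuous_Y].
rewrite /polar_integral; congr EFin; rewrite mulrC /wcoef mulrA; congr (_ * _).
rewrite -(RintegralZl _ mJ i1).
apply: eq_Rintegral => phi _; rewrite gE//; ring.
Qed.

(** The radial integrand is the integrable function [wcoef w k l r * r] times a power of r, which is
    bounded on []0, rad[]. *)
Lemma integrable_polar_integral_gen (s k l : nat) (g : R * R -> R) :
  (1 <= l <= mult k)%N -> is_poly_gen s k l g ->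
  mu.-integrable `]0, rad[ (polar_integral g).
Proof.
move=> hl gE; have [_ /(_ k l hl)[_ iw]] := hw.
have mI := measurable_itvR `]0, rad[.
have mX : measurable_fun `]0, rad[ (fun r : R => r ^+ (2 * s + k)).
  by apply: measurable_in_oo => r _; exact: exprn_continuous.
have bX : [bounded (fun r : R => r ^+ (2 * s + k)) r | r in `]0, rad[].
  exists (rad ^+ (2 * s + k)); split; first exact: num_real.
  move=> x rx r /=; rewrite in_itv/= => /andP[r0 rr].
  rewrite ger0_norm ?exprn_ge0 ?(ltW r0)// (le_trans _ (ltW rx))//.
  by apply: lerXn2r; rewrite ?nnegrE ltW.
have := integrableMr mI mX bX iw.
apply: eq_integrable => // r; rewrite inE/= in_itv/= => hr.
by rewrite (polar_integral_gen gE hr).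
Qed.

(** If [v] vanishes, positivity of the nodes is part of the convention. Otherwise [v] is nonzero at
    some radius, whose square is a point of positivity for the density; for v <= 0 both [v] and the
    coefficients change sign while the nodes stay the same. *)
Lemma gauss_quadrature_nodes_gt0 (N k : nat) (v : R -> R) (t lam : 'I_N -> R) :
  {in `]0, rad[, continuous v} ->
  (forall r, 0 < r < rad -> 0 <= v r) \/ (forall r, 0 < r < rad -> v r <= 0) ->
  gauss_quadrature rad k v t lam -> forall j, 0 < t j.
Proof.
move=> cv sgn [tinc van nvan].
have [/van h j|nv] := pselect (vanishes_on rad v); first by have [_ /andP[]] := h j.
have [_ mom] := nvan nv.
have [r0 [r0r vr0]] : exists r, 0 < r < rad /\ v r != 0.
  apply: contra_notP nv => H r hr; apply/eqP/negPn/negP => vr; apply: H.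
  by exists r.
have injt : injective t.
  move=> i j tij; case: (ltngtP i j) => [/tinc|/tinc|ij]; [by rewrite tij ltxx..|].
  exact: val_inj.
have /andP[r0_gt0 r0_lt] := r0r.
have x0in : r0 ^+ 2 \in `]0, rad ^+ 2[.
  by rewrite in_itv/= exprn_gt0//= ltr_pXn2r// nnegrE ltW.
have sq (x : R) : x \in `]0, rad ^+ 2[ -> 0 < x /\ 0 < Num.sqrt x < rad.
  move=> xr; have := sqrt_in_oo rad0 xr; move: xr; rewrite !in_itv/= => /andP[].
  by [].
case: sgn => sgn.
- apply: (@gauss_node_gt0 R (rad ^+ 2) N t lam
    (fun x => x `^ (k%:R / 2) * v (Num.sqrt x)) (r0 ^+ 2)) => //.
  + exact: continuous_sqrt_density.
  + by move=> x /sq[x0 hx]; rewrite mulr_ge0 ?powR_ge0// sgn.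
  + by rewrite sqrtr_sqr gtr0_norm// mulr_gt0 ?powR_gt0 ?exprn_gt0// lt_neqAle eq_sym vr0 sgn.
- apply: (@gauss_node_gt0 R (rad ^+ 2) N t (fun j => - lam j)
    (fun x => x `^ (k%:R / 2) * - v (Num.sqrt x)) (r0 ^+ 2)) => //.
  + apply: (@continuous_sqrt_density R rad _ (fun r => - v r)) => // r rr.
    by apply: cvgN; exact: cv.
  + by move=> x /sq[x0 hx]; rewrite mulr_ge0 ?powR_ge0// oppr_ge0 sgn.
  + rewrite sqrtr_sqr gtr0_norm// mulr_gt0 ?powR_gt0 ?exprn_gt0//.
    by rewrite oppr_gt0 lt_neqAle vr0 sgn.
  + move=> s /mom; rewrite le0_integralN; last first.
      move=> x /sq[x0 hx]; rewrite mulr_ge0_le0 ?exprn_ge0 ?(ltW x0)//.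
      by rewrite mulr_ge0_le0 ?powR_ge0// sgn.
    move=> /(congr1 oppe); rewrite oppeK -EFinN => E.
    transitivity ((- (\sum_(j < N) lam j * t j ^+ s))%:E).
      by congr EFin; rewrite -sumrN; apply: eq_bigr => j _; rewrite mulNr.
    by rewrite E; apply: eq_integral => x _; rewrite !mulrN.
Qed.

(** If the coefficient of [w] vanishes, the integral is 0, and so is the cubature, all [lam k l j]
    being 0. Otherwise k <= K, and half of the Gauss moment equals the radial moment because rho =
    r^2 has Jacobian 2r. *)
Lemma has_polar_integral_gen (N M K s k l : nat) (t lam : nat -> nat -> 'I_N -> R)
    (g : R * R -> R) : pseudo_definite rad w -> (K < M)%N ->
  (forall k l : nat, (1 <= l <= mult k)%N ->
     gauss_quadrature rad k (wcoef w k l) (t k l) (lam k l)) ->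
  (s <= 2 * N - 1)%N -> (k <= M - 1 - K)%N -> (1 <= l <= mult k)%N ->
  (k <= K)%N \/ vanishes_on rad (wcoef w k l) -> is_poly_gen s k l g ->
  has_polar_integral g (Ipoly M K t lam g).
Proof.
move=> hpd KM hg sN kM hl hK gE.
have [_ /(_ k l hl)[]] := hw; rewrite continuous_open_subspace; last exact: interval_open.
move=> cv _; have {}cv : {in `]0, rad[, continuous (wcoef w k l)}.
  by move=> r rr; apply: cv; rewrite inE.
have sgn := hpd k l hl.
have tpos := gauss_quadrature_nodes_gt0 cv sgn (hg k l hl).
split; [exact: continuous_poly_gen gE|exact: integrable_polar_integral_gen gE|].
rewrite (Ipoly_gen lam KM kM hl tpos gE).
transitivity (\int[mu]_(r in `]0%R, rad[) (r ^+ (2 * s + k) * (wcoef w k l r * r))%:E)%E.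
  apply: eq_integral => r; rewrite inE/= in_itv/= => hr.
  exact: polar_integral_gen.
have [_ van nvan] := hg k l hl.
have [v0|nv] := pselect (vanishes_on rad (wcoef w k l)).
  rewrite integral0_eq; last first.
    by move=> r /=; rewrite in_itv/= => hr; rewrite v0// mul0r mulr0.
  rewrite big1 ?mul0r ?if_same// => j _.
  by have [-> _] := van v0 j; rewrite mul0r.
have kK : (k <= K)%N by case: hK.
rewrite kK EFinM (nvan nv).2// moment_sqr// muleC muleA -EFinM mulVf// mul1e.
by [].
Qed.

Lemma has_polar_integral_lin_span (G : set (R * R -> R)) (I : (R * R -> R) -> R) :
  (forall g, G g -> has_polar_integral g (I g)) ->
  I 0 = 0 -> (forall a g h, I (a *: g + h) = a * I g + I h) ->
  forall f, lin_span G f -> has_polar_integral f (I f).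
Proof.
move=> HG I0 ID _ [n [c [g [Gg ->]]]].
elim: n c g Gg => [|n IH] c g Gg; first by rewrite big_ord0 I0; exact: has_polar_integral0.
rewrite big_ord_recr/= addrC ID; apply: has_polar_integralD; first exact: HG.
exact: (IH (fun i => c (widen_ord (leqnSn n) i)) (fun i => g (widen_ord (leqnSn n) i))).
Qed.

End exactness.

Theorem theorem4 (R : realType) (rad : R) (hrad : 0 < rad)
  (w : R * R -> R) (hw : weight rad w) (hpd : pseudo_definite rad w)
  (N M K : nat) (hN : (1 <= N)%N) (hMK : (K < M)%N)
  (t lam : nat -> nat -> 'I_N -> R)
  (hgauss : forall k l : nat, (1 <= l <= mult k)%N ->
     gauss_quadrature rad k (wcoef w k l) (t k l) (lam k l)) :
  forall f : R * R -> R,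
    lin_span
      [set g : R * R -> R | exists s k l : nat,
        [/\ (s <= 2 * N - 1)%N, (k <= M - 1 - K)%N, (1 <= l <= mult k)%N,
            (k <= K)%N \/ vanishes_on rad (wcoef w k l) & is_poly_gen s k l g]]
      f ->
    disc_integral_eq rad (fun x => f x * w x) (Ipoly M K t lam f).
Proof.
move=> f hf.
have [cf _ If] : has_polar_integral rad w f (Ipoly M K t lam f).
  apply: (has_polar_integral_lin_span hw (I := Ipoly M K t lam)) hf.
  - move=> g [s [k [l [sN kM hl hK gE]]]].
    exact: (has_polar_integral_gen hrad hw hpd hMK hgauss sN kM hl hK gE).
  - exact: Ipoly0.
  - by move=> a g h; exact: IpolyD.
(* The polar equation is [If]. Whenever the planar integral exists, it equals the same radial
   integral, as the product of [f] and [w] is continuous on the punctured disc. *)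
split=> // fw; rewrite integral_open_disc_polar//.
move=> p hp; apply: cvgM; first exact: cf.
exact: (weight_continuous hw hp).
Qed.
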